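(* Let $k$ be a finitely generated field of characteristic zero, let $G$ be an abelian group of finite rank whose torsion subgroup $t(G)$ is Chernikov, and let $P$ be a faithful prime ideal of the group algebra $kG$. Then the controller $c(P)$ of $P$ is a finitely generated subgroup of $G$.
   Context: For a group $G$, a field $k$ and an ideal $I$ of $kG$: $I$ is faithful if $G\cap(1+I)=\{1\}$; a subgroup $H\le G$ controls $I$ if $I=(I\cap kH)kG$; the controller $c(I)$ is the intersection of all subgroups of $G$ controlling $I$ (a subgroup $B$ controls $I$ iff $c(I)\le B$). A Chernikov group is a group with a normal subgroup of finite index that is a direct product of finitely many quasicyclic groups. Finite rank means finite Prüfer (special) rank. *)

(* Defs.v *)
From HB Require Import structures.
From mathcomp Require Import all_boot all_order all_algebra.
From mathcomp Require Import boolp classical_sets functions cardinality fsbigop.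
Set Implicit Arguments. Unset Strict Implicit. Unset Printing Implicit Defensive.
Import Order.TTheory GRing.Theory Num.Theory.
Local Open Scope classical_set_scope.
Local Open Scope ring_scope.

Definition subgroup (G : zmodType) (H : set G) : Prop :=
  H 0 /\ (forall x y, H x -> H y -> H (x - y)).

Definition span (G : zmodType) (s : seq G) : set G :=
  [set g | exists z : 'I_(size s) -> int, g = \sum_(i < size s) s`_i *~ z i].

Definition fin_gen_subgroup (G : zmodType) (H : set G) : Prop :=
  exists s : seq G, H = span s.

Definition finite_rank (G : zmodType) : Prop :=
  exists r : nat, forall s : seq G,
    exists t : seq G, (size t <= r)%N /\ span t = span s.

Definition torsion (G : zmodType) : set G :=
  [set g | exists n : nat, (0 < n)%N /\ g *+ n = 0].
Arguments torsion : clear implicits.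

(* Q is a quasicyclic (Pruefer p^oo) subgroup: the union of a chain of cyclic
   subgroups <x 0> < <x 1> < ... with x 0 of order p and p x(n+1) = x n *)
Definition quasicyclic (G : zmodType) (Q : set G) : Prop :=
  exists (p : nat) (x : nat -> G),
    [/\ prime p, x 0%N != 0, x 0%N *+ p = 0,
        (forall n, x n.+1 *+ p = x n) &
        Q = [set g | exists n m : nat, g = x n *+ m]].

(* The (abelian) subgroup T is Chernikov: it has a subgroup D of finite index
   which is the (internal) direct product of finitely many quasicyclic
   subgroups Q_0, ..., Q_(m-1). *)
Definition chernikov (G : zmodType) (T : set G) : Prop :=
  exists (m : nat) (Q : 'I_m -> set G) (c : seq G),
    let D := [set g | exists q : 'I_m -> G,
                 (forall i, Q i (q i)) /\ g = \sum_(i < m) q i] in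
    [/\ (forall i, quasicyclic (Q i)),
        (forall q : 'I_m -> G, (forall i, Q i (q i)) ->
            \sum_(i < m) q i = 0 -> forall i, q i = 0),
        D `<=` T &
        (forall t, T t -> exists d j, D d /\ t = d + c`_j)].

Definition subfield (k : fieldType) (S : set k) : Prop :=
  [/\ S 1, (forall x y, S x -> S y -> S (x - y)),
      (forall x y, S x -> S y -> S (x * y)) & (forall x, S x -> S x^-1)].

Definition fin_gen_field (k : fieldType) : Prop :=
  exists s : seq k, forall S : set k, subfield S ->
    (forall x, x \in s -> S x) -> S = setT.

(* ---------- The group algebra kG ----------
   Elements of kG are the finitely supported functions G -> k
   (f = \sum_g f(g) g); addition is pointwise, multiplication is convolution. *)

Definition kG (k : fieldType) (G : zmodType) : set (G -> k) :=
  [set f | finite_set [set g | f g != 0]].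
Arguments kG : clear implicits.

Definition kG_add (k : fieldType) (G : zmodType) (f g : G -> k) : G -> k :=
  fun x => f x + g x.

Definition kG_mul (k : fieldType) (G : zmodType) (f g : G -> k) : G -> k :=
  fun x => \sum_(h \in [set: G]) f h * g (x - h).

Definition kG_elt (k : fieldType) (G : zmodType) (g : G) : G -> k :=
  fun x => if x == g then 1 else 0.

(* ideal of kG (kG is commutative) *)
Definition ideal (k : fieldType) (G : zmodType) (I : set (G -> k)) : Prop :=
  [/\ I `<=` kG k G, I (fun _ => 0),
      (forall a b, I a -> I b -> I (kG_add a (fun x => - b x))) &
      (forall a b, I a -> kG k G b -> I (kG_mul a b))].

Definition prime_ideal (k : fieldType) (G : zmodType) (I : set (G -> k)) : Prop :=
  [/\ ideal I, ~ I (@kG_elt k G 0) &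
      (forall a b, kG k G a -> kG k G b -> I (kG_mul a b) -> I a \/ I b)].

Definition faithful (k : fieldType) (G : zmodType) (I : set (G -> k)) : Prop :=
  forall g : G, I (kG_add (kG_elt k g) (fun x => - kG_elt k 0 x)) -> g = 0.

Definition kSub (k : fieldType) (G : zmodType) (H : set G) : set (G -> k) :=
  [set f | kG k G f /\ (forall g, f g != 0 -> H g)].

Definition ideal_gen (k : fieldType) (G : zmodType) (J : set (G -> k))
  : set (G -> k) :=
  [set f | exists (n : nat) (a b : 'I_n -> G -> k),
     [/\ (forall i, J (a i)), (forall i, kG k G (b i)) &
         f = (fun x => \sum_(i < n) kG_mul (a i) (b i) x)]].

Definition controls (k : fieldType) (G : zmodType) (H : set G)
  (I : set (G -> k)) : Prop :=
  I = ideal_gen (I `&` @kSub k G H).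

Definition controller (k : fieldType) (G : zmodType) (I : set (G -> k))
  : set G :=
  [set g | forall H : set G, subgroup H -> controls H I -> H g].

(* Main.v *)
From HB Require Import structures.
From mathcomp Require Import all_boot all_order all_algebra all_field.
From mathcomp Require Import boolp classical_sets functions cardinality fsbigop.
From mathcomp Require Import ring zify.
Require Import Defs.
Import Order.TTheory GRing.Theory Num.Theory.
Set Implicit Arguments. Unset Strict Implicit. Unset Printing Implicit Defensive.
Local Open Scope ring_scope.
Local Open Scope quotient_scope.

(* Let F be the fraction field of kG/P and chi : G -> F^* the induced character,
   injective because P is faithful. A subgroup H controls P as soon as distinct
   cosets of H have representatives whose images under chi are linearly
   independent over a subfield E containing k and chi(H). We look for a finitely
   generated field E such that H = chi^-1(E) works.

   (1) H is finitely generated. G is torsion over a finitely generated H0, so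
   H is made of radicals, inside E, of elements of H0. After division by an
   element of chi(H0), such a radical y satisfies y^n = prod h_i^(b_i) with
   0 <= b_i < n, and only finitely many y in E do so: E is algebraic over a purely
   transcendental extension of the rationals, and the minimal polynomial of y over
   the latter has bounded size (the n-th power of a root is an eigenvalue of a
   product of at most r n matrices from a fixed finite list).

   (2) Linear independence is Kummer theory without roots of unity, in the spirit
   of Capelli and Kneser: if every root of unity of prime order in E^* chi(G) lies
   in E, and E contains the square roots of -1 of F, then the minimal polynomial
   over E of chi(g), for g outside H, is X^n - b with n > 1. Hence chi(g) has trace
   zero, and the trace singles out each coefficient of a linear relation.

   (3) E is obtained by adjoining to a field E0 of finite type all the p-th roots of
   unity in F with p <= B prime. The bound B comes from (1) and from the finiteness
   of the set of primes dividing orders of torsion elements of G. A norm from E to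
   E0, whose degree has only prime factors <= B, rules out new roots of unity. *)

(** * Radicals in a finitely generated field *)

(** Asking only for a covering list makes the notion pass to subsets with no decision procedure for
    [A]. *)
Definition finitely_many (T : eqType) (A : T -> Prop) : Prop :=
  exists s : seq T, forall x, A x -> x \in s.

Lemma finitely_many_inj (T U : eqType) (A : T -> Prop) (B : U -> Prop)
    (f : T -> U) :
  (forall x, A x -> B (f x)) ->
  (forall x y, A x -> A y -> f x = f y -> x = y) ->
  finitely_many B -> finitely_many A.
Proof.
move=> AB finj [s sB].
have {AB sB} : forall x, A x -> f x \in s by move=> x /AB /sB.
elim: s A finj => [|u s IHs] A finj As.
  by exists [::] => x /As; rewrite in_nil.
have [[x0 [Ax0 fx0]]|nox] := pselect (exists x, A x /\ f x = u).
  have [t Ht] : finitely_many (fun x => A x /\ f x <> u).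
    apply: IHs => [x y [Ax _] [Ay _]|x]; first exact: finj.
    by case=> /As; rewrite inE => /orP[/eqP|].
  exists (x0 :: t) => x Ax; rewrite inE.
  have [fx|fx] := eqVneq (f x) u; last by rewrite Ht ?orbT //; split => //; apply/eqP.
  by rewrite (finj x x0) ?eqxx // fx.
apply: IHs => // x Ax; move: (As x Ax); rewrite inE => /orP[/eqP fx|//].
by case: nox; exists x.
Qed.

Lemma finitely_many_image (T U : eqType) (A : T -> Prop) (B : U -> Prop)
    (f : T -> U) :
  (forall y, B y -> exists2 x, A x & f x = y) ->
  finitely_many A -> finitely_many B.
Proof.
move=> BA [s sA]; exists [seq f x | x <- s] => y /BA[x /sA xs <-].
exact: map_f.
Qed.

Lemma finitely_many_seqs (T : eqType) (s : seq T) n :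
  finitely_many (fun t : seq T => size t = n /\ {subset t <= s}).
Proof.
elim: n => [|n [L HL]].
  by exists [:: [::]] => t [/size0nil ->]; rewrite inE.
exists [seq x :: t | x <- s, t <- L] => -[|x t] [] //= [st] sub.
apply/allpairsP; exists (x, t); split => //=.
  by apply: sub; rewrite mem_head.
by apply: HL; split=> // y yt; apply: sub; rewrite inE yt orbT.
Qed.

Lemma finitely_many_poly (R : nzRingType) (s : seq R) n :
  finitely_many (fun p : {poly R} => (size p <= n)%N /\
     forall i, (i < n)%N -> p`_i \in s).
Proof.
apply: (@finitely_many_image _ _ (fun t : seq R => size t = n /\ {subset t <= s})
  _ (fun t => Poly t)); last exact: finitely_many_seqs.
move=> p [sp ps]; exists (mkseq (fun i => p`_i) n).
  split; first by rewrite size_mkseq.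
  by move=> x /(nthP 0)[i]; rewrite size_mkseq => lin <-; rewrite nth_mkseq // ps.
apply/polyP => i; rewrite coef_Poly.
have [lin|lein] := ltnP i n; first by rewrite nth_mkseq.
by rewrite !nth_default // ?size_mkseq // (leq_trans sp).
Qed.

(* Exponent vectors b <= n in r matrices are encoded by lists of length r n over
   BB (padded with identity matrices), a shape stable under ring morphisms and
   under scaling BB by a constant. *)
Definition bounded_root_poly (K : fieldType) d r e (BB : seq 'M[K]_d.+1)
    (chi : {poly K}) : Prop :=
  [/\ chi \is monic, (size chi <= e.+1)%N &
    exists n ws, [/\ (0 < n)%N, size ws = (r * n)%N, {subset ws <= BB} &
      chi %| char_poly (\prod_(w <- ws) w) \Po 'X^n]].

(** A finiteness property in the manner of Northcott: the matrices bound the heights of the roots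
    and [e] bounds the degree, while the exponent [n] is free. Quantifying over all [d], [r], [e]
    and [BB] lets it pass from K to K(X), where the matrices get rescaled and specialised. *)
Definition northcott (K : fieldType) : Prop :=
  forall d r e (BB : seq 'M[K]_d.+1), finitely_many (bounded_root_poly r e BB).

Lemma scale_prod (R : comNzRingType) d (m : R) (ws : seq 'M[R]_d.+1) :
  \prod_(w <- ws) (m *: w) = m ^+ size ws *: \prod_(w <- ws) w.
Proof.
elim: ws => [|w ws IH]; first by rewrite !big_nil expr0 scale1r.
by rewrite !big_cons IH -scalerAl -scalerAr scalerA -exprS.
Qed.

Lemma comp_polyXn_monic (R : idomainType) (p : {poly R}) n : (0 < n)%N ->
  p \is monic -> p \Po 'X^n \is monic.
Proof.
move=> n0 pm; rewrite monicE lead_coef_comp ?size_polyXn //.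
by rewrite (monicP pm) lead_coefXn expr1n mulr1.
Qed.

(** * The rational case: denominators and absolute values *)

Section Rat.
Variables (d r e : nat) (BB : seq 'M[rat]_d.+1).

Lemma common_denominator_rat :
  exists2 m : nat, (0 < m)%N & forall B, B \in BB -> forall i j,
    m%:R * B i j \is a Num.int.
Proof.
elim: BB => [|B L [m m0 Hm]]; first by exists 1%N.
pose c := (\prod_(ij : 'I_d.+1 * 'I_d.+1) `|denq (B ij.1 ij.2)|)%N.
have c0 : (0 < c)%N.
  by apply: prodn_gt0 => -[i j]; rewrite absz_gt0 denq_neq0.
have cB i j : c%:R * B i j \is a Num.int.
  rewrite /c (bigD1 (i, j)) //= natrM mulrAC rpredM ?rpred_nat //.
  by rewrite mulrC pmulrn absz_denq -numqE rpred_int.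
exists (c * m)%N; first by rewrite muln_gt0 c0.
move=> B'; rewrite inE => /orP[/eqP ->|B'L] i j; rewrite natrM.
  by rewrite mulrAC rpredM ?rpred_nat.
by rewrite -mulrA rpredM ?rpred_nat ?Hm.
Qed.

Definition l1 (v : 'rV[algC]_d.+1) : algC := \sum_i `|v 0 i|.

Lemma l1_gt0 v : v != 0 -> 0 < l1 v.
Proof.
move=> v0; rewrite lt_def sumr_ge0 ?andbT //.
apply: contraNneq v0 => /eqP; rewrite psumr_eq0 // => /allP v0.
apply/eqP/rowP => i; rewrite !mxE; apply/eqP; rewrite -normr_eq0.
exact: (v0 i (mem_index_enum _)).
Qed.

Lemma l1_scale a v : l1 (a *: v) = `|a| * l1 v.
Proof.
by rewrite /l1 mulr_sumr; apply: eq_bigr => i _; rewrite mxE normrM.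
Qed.

Lemma l1_mul (B : 'M_d.+1) v : l1 (v *m B) <= (\sum_i \sum_j `|B i j|) * l1 v.
Proof.
rewrite /l1 mulr_suml.
apply: (@le_trans _ _ (\sum_j \sum_i `|v 0 i| * `|B i j|)).
  apply: ler_sum => j _; rewrite mxE.
  apply: le_trans (ler_norm_sum _ _ _) _.
  by apply: ler_sum => i _; rewrite normrM.
rewrite exchange_big /=; apply: ler_sum => i _.
rewrite -mulr_sumr mulrC ler_wpM2l ?sumr_ge0 //.
by rewrite (bigD1 i) //= lerDl sumr_ge0.
Qed.

Lemma l1_prod C (ws : seq 'M[algC]_d.+1) v : 0 <= C ->
  (forall B, B \in ws -> \sum_i \sum_j `|B i j| <= C) ->
  l1 (v *m \prod_(w <- ws) w) <= C ^+ size ws * l1 v.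
Proof.
move=> C0; elim: ws v => [|B ws IH] v HC.
  by rewrite big_nil expr0 mul1r mulmx1.
rewrite big_cons -mulmxE mulmxA.
have H1 : l1 (v *m B) <= C * l1 v.
  apply: le_trans (l1_mul _ _) _; apply: ler_wpM2r.
    by rewrite sumr_ge0.
  by apply: HC; rewrite mem_head.
apply: le_trans (IH _ _) _; first by move=> B' B's; rewrite HC // inE B's orbT.
by rewrite /= exprSr -mulrA ler_wpM2l // exprn_ge0.
Qed.

Lemma prod_XsubC_bound (M C : algC) (rs : seq algC) : 0 <= C ->
  M \in Aint ->
  (forall x, x \in rs -> M * x \in Aint /\ `|x| <= C) ->
  forall i, M ^+ size rs * (\prod_(x <- rs) ('X - x%:P))`_i \in Aint /\
            `|(\prod_(x <- rs) ('X - x%:P))`_i| <= (1 + C) ^+ size rs.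
Proof.
move=> C0 MA; elim: rs => [|x rs IH] H i.
  rewrite big_nil !expr0 mul1r coef1; split.
    by case: eqP => _; rewrite ?Aint1 ?Aint0.
  by case: eqP => _; rewrite ?normr1 ?normr0 ?ler01.
have [Mx xC] := H x (mem_head _ _).
have {}IH := IH (fun y ys => H y (mem_behead (s := x :: rs) ys)).
rewrite big_cons mulrBl coefB coefXM coefCM.
set p := \prod_(_ <- _) _ in IH *.
have [IH1 IH2] : M ^+ size rs * (if i == 0%N then 0 else p`_i.-1) \in Aint /\
   `|(if i == 0%N then 0 else p`_i.-1)| <= (1 + C) ^+ size rs.
  case: eqP => _; last exact: IH.
  by rewrite mulr0 normr0 Aint0 exprn_ge0 ?addr_ge0.
have [IH3 IH4] := IH i.
split.
  have h1 : M ^+ (size rs).+1 * (x * p`_i) \in Aint.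
    by rewrite exprS mulrACA; apply: rpredM.
  have h2 : M ^+ (size rs).+1 * (if i == 0%N then 0 else p`_i.-1) \in Aint.
    by rewrite exprS -mulrA; apply: rpredM.
  by rewrite mulrBr; apply: rpredB.
rewrite exprS mulrDl mul1r.
apply: le_trans (ler_normB _ _) _; apply: lerD => //.
by rewrite normrM ler_pM.
Qed.

(** For a complex root x of [chi], x^n is an eigenvalue of a product of r n matrices of [BB]. The
    [l1] norm gives |x|^n <= C^(r n), hence |x| <= C^r; clearing denominators makes m^r x an
    algebraic integer. Neither bound depends on n, so the coefficients of [chi] have a fixed
    denominator and bounded size. *)
Lemma bounded_root_poly_rat : finitely_many (bounded_root_poly r e BB).
Proof.
have [m m0 Hm] := common_denominator_rat.
pose toZ (B : 'M[rat]_d.+1) : 'M[int]_d.+1 :=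
  map_mx (fun x => numq (m%:R * x)) B.
have toZE B : B \in BB -> map_mx (intr : int -> rat) (toZ B) = m%:R *: B.
  move=> BBB; apply/matrixP => i j; rewrite !mxE.
  by have /intrP[z ->] := Hm B BBB i j; rewrite numq_int.
pose toC := map_mx (ratr : rat -> algC).
pose C : algC := \sum_(B <- BB) \sum_i \sum_j `|toC d.+1 d.+1 B i j|.
have sge0 (B : 'M[algC]_d.+1) : 0 <= \sum_i \sum_j `|B i j|.
  by apply: sumr_ge0 => i _; apply: sumr_ge0 => j _; exact: normr_ge0.
have C0 : 0 <= C by apply: sumr_ge0.
have HC B : B \in BB -> \sum_i \sum_j `|toC d.+1 d.+1 B i j| <= C.
  by move=> BBB; rewrite /C (perm_big _ (perm_to_rem BBB)) big_cons /= lerDl sumr_ge0.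
pose M : algC := (m ^ r)%:R.
have M0 : M != 0 by rewrite pnatr_eq0 expn_eq0 negb_and -lt0n m0.
have MA : M \in Aint by rewrite /M pmulrn Aint_int.
have [N HN] : exists N : nat, (M * (1 + C ^+ r)) ^+ e <= N%:R.
  exists (Num.bound ((M * (1 + C ^+ r)) ^+ e)); apply: ltW; apply: archi_boundP.
  by rewrite exprn_ge0 // mulr_ge0 ?ler0n // addr_ge0 ?exprn_ge0.
(* The fractions with denominator m^(r e) and numerator from -N to N, the numerators being listed as
   naturals up to 2 N and shifted by N. *)
pose L : seq rat := [seq (z%:~R - N%:R) / (m ^ r)%:R ^+ e | z <- map Posz (iota 0 (2 * N).+1)].
have [S HS] := finitely_many_poly L e.+1; exists S => chi [mon sz [n [ws [n0 sws sub dv]]]].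
apply: HS; split=> // i _.
have [rs Hrs] := closed_field_poly_normal (map_poly (ratr : rat -> algC) chi).
rewrite (monicP _) ?map_monic // scale1r in Hrs.
have szrs : (size rs <= e)%N.
  by rewrite -ltnS -(size_prod_XsubC rs id) -Hrs size_map_poly.
have Hroots : forall x, x \in rs -> M * x \in Aint /\ `|x| <= C ^+ r.
  move=> x xrs.
  have rx : root (map_poly ratr chi) x by rewrite Hrs root_prod_XsubC.
  have : root (map_poly (ratr : rat -> algC) (char_poly (\prod_(w <- ws) w) \Po 'X^n)) x.
    by move: rx; rewrite -!dvdp_XsubCl => /dvdp_trans; apply; rewrite dvdp_map.
  rewrite map_comp_poly map_polyXn map_char_poly rootE horner_comp hornerXn -rootE.
  rewrite -eigenvalue_root_char => /eigenvalueP[v vW v0].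
  pose Wz : 'M[int]_d.+1 := \prod_(w <- ws) toZ w.
  have WzE : map_mx (intr : int -> algC) Wz = M ^+ n *: toC _ _ (\prod_(w <- ws) w).
    have -> : map_mx (intr : int -> algC) Wz = toC _ _ (map_mx intr Wz).
      by apply/matrixP => a b; rewrite !mxE ratr_int.
    rewrite rmorph_prod /= (eq_big_seq (fun w => m%:R *: w)); last first.
      by move=> w /sub; exact: toZE.
    rewrite scale_prod sws /M natrX -exprM.
    by apply/matrixP => a b; rewrite !mxE rmorphM /= rmorphXn /= ratr_nat.
  split.
    have : root (char_poly (map_mx (intr : int -> algC) Wz) \Po 'X^n) (M * x).
      rewrite rootE horner_comp hornerXn -rootE -eigenvalue_root_char.
      apply/eigenvalueP; exists v => //.
      by rewrite WzE -scalemxAr vW scalerA exprMn.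
    move/root_monic_Aint; apply.
      exact: comp_polyXn_monic n0 (char_poly_monic _).
    rewrite -map_char_poly; apply/polyOverP => k.
    rewrite -[_ \Po _](_ : map_poly intr (char_poly Wz \Po 'X^n) = _).
      by rewrite coef_map /= rpred_int.
    by rewrite map_comp_poly map_polyXn.
  have : l1 (x ^+ n *: v) <= (C ^+ r) ^+ n * l1 v.
    rewrite -vW /toC rmorph_prod -exprM -sws.
    have := @l1_prod C (map (@toC d.+1 d.+1) ws) v C0; rewrite big_map size_map; apply.
    by move=> B /mapP[w /sub wBB ->]; exact: HC.
  rewrite l1_scale normrX ler_pM2r ?l1_gt0 // ler_pXn2r ?nnegrE ?exprn_ge0 //.
have [H1 H2] := prod_XsubC_bound (exprn_ge0 r C0) MA Hroots i.
rewrite -Hrs coef_map /= in H1 H2.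
have {H1} : M ^+ e * ratr chi`_i \in Aint.
  by rewrite -(subnK szrs) exprD -mulrA; apply: rpredM => //; apply: rpredX.
have -> : M ^+ e * ratr chi`_i = ratr ((m ^ r)%:R ^+ e * chi`_i).
  by rewrite rmorphM /= rmorphXn /= ratr_nat.
have ratE := rmorphM (ratr : rat -> algC) ((m ^ r)%:R ^+ e) chi`_i.
move=> Aic; have : ratr ((m ^ r)%:R ^+ e * chi`_i) \in (Num.int : {pred algC}).
  by apply: Cint_rat_Aint => //; exact: Crat_rat.
rewrite Cint_rat => /intrP[z zE].
have zN : `|z| <= N%:Z.
  rewrite -(ler_int algC) intr_norm -(ratr_int _ z) -zE ratE normrM.
  apply: le_trans HN; rewrite rmorphXn /= ratr_nat -/M normrX [`|M|]ger0_norm ?ler0n //.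
  rewrite exprMn ler_wpM2l ?exprn_ge0 ?ler0n //.
  apply: le_trans H2 _; apply: ler_weXn2l => //.
  by rewrite lerDl exprn_ge0.
have mr0 : (m ^ r)%:R ^+ e != 0 :> rat by rewrite expf_neq0 // pnatr_eq0 expn_eq0 negb_and -lt0n m0.
apply/mapP; exists (z + N%:Z).
  have /ler_normlP[z1 z2] := zN.
  have : 0 <= z + N%:Z by rewrite -lerBlDr sub0r -lerN2 opprK.
  case: (z + N%:Z) (lerD z2 (lexx N%:Z)) => // k; rewrite -PoszD lez_nat => kN _.
  by rewrite map_f // mem_iota ltnS mul2n -addnn.
by rewrite rmorphD /= -pmulrn addrK -zE mulrC mulKf.
Qed.
End Rat.

Lemma northcott_rat : northcott rat.
Proof. by move=> d r e BB; exact: bounded_root_poly_rat. Qed.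

(** * From K to K(X): Gauss's lemma and a weighted degree *)

Lemma size_det_leq (R : comNzRingType) M n (A : 'M[{poly R}]_n) :
  (forall i j, size (A i j) <= M.+1)%N -> (size (\det A) <= (M * n).+1)%N.
Proof.
move=> HA; rewrite /determinant.
apply: leq_trans (size_sum _ _ _) _; apply/bigmax_leqP => s _.
rewrite mulr_sign (fun_if (fun p : {poly R} => size p)) size_polyN if_same.
apply: leq_trans (size_prod_leq _ _) _.
rewrite leq_subLR; apply: (@leq_trans (\sum_(i < n) M.+1).+1).
  by rewrite ltnS; apply: leq_sum => i _.
by rewrite sum_nat_const card_ord mulnS addnS [(n * M)%N]mulnC.
Qed.

Lemma size_prod_mx_leq (R : nzRingType) D d (ws : seq 'M[{poly R}]_d.+1) :
  (forall B, B \in ws -> forall i j, (size (B i j) <= D.+1)%N) ->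
  forall i j, (size (((\prod_(w <- ws) w)%R : 'M__) i j) <= (D * size ws).+1)%N.
Proof.
elim: ws => [|w ws IH] H i j.
  rewrite big_nil mxE muln0; case: eqP => _; by rewrite ?size_poly1 ?size_poly0.
rewrite big_cons mxE; apply: leq_trans (size_sum _ _ _) _; apply/bigmax_leqP => k _.
apply: leq_trans (size_polyMleq _ _) _.
have h1 := H w (mem_head _ _) i k.
have h2 := IH (fun B Bs => H B (mem_behead (s := w :: ws) Bs)) k j.
rewrite -subn1 leq_subLR add1n; apply: leq_trans (leq_add h1 h2) _.
by rewrite addSn addnS mulnS.
Qed.

Lemma char_poly_scale (K : fieldType) d (a : K) (W : 'M[K]_d) : a != 0 ->
  char_poly (a *: W) = a ^+ d *: (char_poly W \Po (a^-1 *: 'X)).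
Proof.
move=> a0; rewrite /char_poly -(det_map_mx (comp_poly (a^-1 *: 'X))).
rewrite -mul_polyC rmorphXn /= -detZ; congr (\det _).
apply/matrixP => i j; rewrite !mxE rmorphB rmorphMn /= comp_polyC comp_polyX.
by rewrite mulrBr -polyCM mulrnAr mul_polyC scalerA mulfV // scale1r.
Qed.

(** A nonconstant divisor of least size is prime: its gcd with x is a unit or, by minimality, an
    associate of it. *)
Lemma prime_factor (K : fieldType) (c : {poly K}) : (1 < size c)%N ->
  exists pi : {poly K}, [/\ (1 < size pi)%N, pi %| c &
    forall x y, pi %| x * y -> pi %| x \/ pi %| y].
Proof.
move=> c1.
have ex : exists n, `[< exists pi : {poly K}, [/\ (1 < size pi)%N, pi %| c & size pi = n] >].
  by exists (size c); apply/asboolP; exists c; split.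
have [n /asboolP[pi [pi1 pic szpi]] nmin] := ex_minnP ex; exists pi; split=> // x y.
have [cop|ncop] := boolP (coprimep pi x).
  by rewrite Gauss_dvdpr //; right.
left; have g0 : gcdp pi x != 0.
  by rewrite gcdp_eq0 negb_and -size_poly_gt0 (ltn_trans _ pi1).
have g1 : (1 < size (gcdp pi x))%N.
  rewrite ltn_neqAle eq_sym size_poly_gt0 g0 andbT; exact: ncop.
have : (n <= size (gcdp pi x))%N.
  apply: nmin; apply/asboolP; exists (gcdp pi x); split=> //.
  exact: dvdp_trans (dvdp_gcdl _ _) pic.
rewrite -szpi => le.
have : gcdp pi x %= pi.
  rewrite -dvdp_size_eqp ?dvdp_gcdl // eqn_leq le dvdp_leq ?dvdp_gcdl //.
  by rewrite -size_poly_gt0 (ltn_trans _ pi1).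
by rewrite eqp_sym => /eqp_dvdl ->; exact: dvdp_gcdr.
Qed.

(* Reduce the coefficients modulo the prime: if neither reduction vanishes, the
   product of their leading coefficients is not divisible by the prime. *)
Lemma prime_dvd_coefs (K : fieldType) (pi : {poly K}) (a b : {poly {poly K}}) :
  (forall x y, pi %| x * y -> pi %| x \/ pi %| y) ->
  (forall i, pi %| (a * b)`_i) ->
  (exists a' : {poly {poly K}}, a = pi *: a') \/ (exists b' : {poly {poly K}}, b = pi *: b').
Proof.
move=> pr ab.
pose r (u : {poly {poly K}}) := \poly_(i < size u) (u`_i %% pi).
pose q (u : {poly {poly K}}) := \poly_(i < size u) (u`_i %/ pi).
have E u : u = pi *: q u + r u.
  apply/polyP => i; rewrite coefD coefZ !coef_poly; case: ltnP => iu.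
    by rewrite mulrC -divp_eq.
  by rewrite mulr0 addr0 nth_default.
have [ra|ra] := eqVneq (r a) 0; first by left; exists (q a); rewrite {1}(E a) ra addr0.
have [rb|rb] := eqVneq (r b) 0; first by right; exists (q b); rewrite {1}(E b) rb addr0.
have rab i : pi %| (r a * r b)`_i.
  have -> : r a * r b = a * b - pi *: (q a * b + r a * q b).
    have Er u : r u = u - pi%:P * q u by rewrite mul_polyC {2}(E u) addrC addKr.
    rewrite (Er a) (Er b) -!mul_polyC; ring.
  by rewrite coefB coefZ dvdp_sub ?dvdp_mulIl.
have nd u : r u != 0 -> ~ pi %| lead_coef (r u).
  move=> ru; rewrite lead_coefE {1}/r coef_poly.
  have lt : ((size (r u)).-1 < size u)%N.
    by rewrite prednK ?size_poly_gt0 // size_poly.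
  rewrite lt /dvdp modp_id => /eqP m0; move/eqP: ru; apply.
  by apply/eqP; rewrite -lead_coef_eq0 lead_coefE {1}/r coef_poly lt m0.
have := rab (size (r a * r b)).-1; rewrite -lead_coefE lead_coefM.
by case/pr => [/(nd _ ra)|/(nd _ rb)].
Qed.

Lemma fractionP (R : idomainType) (x : {fraction R}) :
  exists n d : R, d != 0 /\ x * tofrac d = tofrac n.
Proof.
elim/quotW: x => r; exists (frac r).1, (frac r).2; split; first exact: denom_ratioP.
have -> : tofrac (frac r).1 = \pi_({fraction R})%qT (Ratio (frac r).1 1) by rewrite piE.
have -> : tofrac (frac r).2 = \pi_({fraction R})%qT (Ratio (frac r).2 1) by rewrite piE.
rewrite -[_ * _]/(FracField.mul _ _) !piE; apply/eqP.
rewrite FracField.equivf_def /FracField.mulf.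
have d0 := denom_ratioP r.
by rewrite !numden_Ratio ?mulf_neq0 ?oner_eq0 // !mulr1 mulrC.
Qed.

Lemma poly_common_denominator (R : idomainType) (p : {poly {fraction R}}) :
  exists2 c : R, c != 0 & exists a : {poly R}, tofrac c *: p = map_poly (@tofrac _) a.
Proof.
elim/poly_ind: p => [|p x [c c0 [a ca]]].
  by exists 1; rewrite ?oner_neq0 //; exists 0; rewrite scaler0 rmorph0.
have [n [d [d0 xd]]] := fractionP x.
exists (c * d); first by rewrite mulf_neq0.
exists (d *: a * 'X + (c * n)%:P).
have -> : map_poly (@tofrac R) (d *: a * 'X + (c * n)%:P) =
    tofrac d *: map_poly (@tofrac R) a * 'X + (tofrac (c * n))%:P.
  by rewrite rmorphD /= rmorphM /= linearZ /= map_polyX map_polyC.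
rewrite -ca.
rewrite !tofracM -xd -!mul_polyC !polyCM; ring.
Qed.

Lemma seq_common_denominator (R : idomainType) (xs : seq {fraction R}) :
  exists2 c : R, c != 0 & forall x, x \in xs -> exists a, tofrac c * x = tofrac a.
Proof.
elim: xs => [|x xs [c c0 Hc]]; first by exists 1; rewrite ?oner_neq0.
have [n [d [d0 xd]]] := fractionP x.
exists (c * d); first by rewrite mulf_neq0.
move=> y; rewrite inE => /orP[/eqP ->|/Hc[a ya]].
  by exists (c * n); rewrite !tofracM -xd; ring.
by exists (d * a); rewrite !tofracM -ya; ring.
Qed.

(** Gauss's lemma for K[X]. Clearing denominators gives c e p = a b, where c and e are the leading
    coefficients of a and b. A prime factor of c e divides a or b, hence also c or e, and is
    cancelled; the induction on the sizes of c and e stops when both are units. *)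
Lemma monic_dvd_integral (K : fieldType) (p : {poly {poly K}})
    (chi : {poly {fraction {poly K}}}) :
  p \is monic -> chi \is monic -> chi %| map_poly (@tofrac _) p ->
  exists chi' q', chi = map_poly (@tofrac _) chi' /\ p = chi' * q'.
Proof.
move=> pm chim /dvdpP[s pE].
have sm : s \is monic.
  by rewrite -(monicMr _ chim) -pE monic_map.
have tinj : injective (@tofrac {poly K}) by move=> x y /eqP; rewrite tofrac_eq => /eqP.
have [c c0 [a ca]] := poly_common_denominator chi.
have [e e0 [b eb]] := poly_common_denominator s.
have [N] := ubnP (size c + size e)%N.
elim: N c e a b c0 e0 ca eb => // N IH c e a b c0 e0 ca eb; rewrite ltnS => szN.
have la : lead_coef a = c.
  apply: (tinj); have /(congr1 lead_coef) := ca.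
  by rewrite lead_coefZ (monicP chim) mulr1 (lead_coef_map_inj tinj (rmorph0 _)) => ->.
have lb : lead_coef b = e.
  apply: (tinj); have /(congr1 lead_coef) := eb.
  by rewrite lead_coefZ (monicP sm) mulr1 (lead_coef_map_inj tinj (rmorph0 _)) => ->.
have ab : (c * e) *: p = a * b.
  apply: (map_inj_poly tinj (rmorph0 _)).
  rewrite linearZ [RHS]rmorphM /= -ca -eb pE tofracM.
  by rewrite -scalerAl -scalerAr scalerA [s * chi]mulrC.
have cst (x : {poly K}) : (size x <= 1)%N -> x != 0 -> exists y, y * x = 1.
  move=> /size1_polyC ->; rewrite polyC_eq0 => u0.
  by exists (x`_0)^-1%:P; rewrite -polyCM mulVf.
have [ce1|ce1] := leqP (size (c * e)) 1.
  have : (size c <= 1)%N /\ (size e <= 1)%N.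
    move: ce1; rewrite size_mul //.
    by move: (size c) (size e) (size_poly_gt0 c) (size_poly_gt0 e); rewrite c0 e0; lia.
  case=> /cst-/(_ c0)[c' c'c] /cst-/(_ e0)[e' e'e].
  exists (c' *: a), (e' *: b); split.
    by rewrite linearZ /= -ca scalerA -tofracM c'c tofrac1 scale1r.
  by rewrite -scalerAl -scalerAr -ab !scalerA mulrACA c'c e'e mulr1 scale1r.
have [pi [pi1 pic pr]] := prime_factor ce1.
have pi0 : pi != 0 by rewrite -size_poly_gt0 ltnW.
have less (x y : {poly K}) : x = pi * y -> x != 0 -> y != 0 /\ (size y < size x)%N.
  move=> -> /[!mulf_eq0] /norP[_ y0]; split=> //.
  rewrite size_mul //; move: pi1 (size_poly_gt0 y); rewrite y0.
  by move: (size pi) (size y) => u v; lia.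
(* As [x] is the leading coefficient of [u], a factor [pi] of [u] also divides [x] and cancels from
   both sides. *)
have key (x : {poly K}) (u : {poly {poly K}}) (t : {poly {fraction {poly K}}})
    (u' : {poly {poly K}}) : tofrac x *: t = map_poly (@tofrac _) u ->
   lead_coef u = x -> u = pi *: u' -> x != 0 ->
   exists y : {poly K}, [/\ y != 0, (size y < size x)%N & tofrac y *: t = map_poly (@tofrac _) u'].
  move=> xt lu uE x0.
  have xE : x = pi * lead_coef u' by rewrite -lu uE lead_coefZ.
  have [y0 sy] := less _ _ xE x0.
  exists (lead_coef u'); split => //.
  apply: (scalerI (a := @tofrac _ pi)); first by rewrite tofrac_eq0.
  by rewrite scalerA -tofracM -xE xt uE linearZ.
have [|[a' aE]|[b' bE]] := prime_dvd_coefs pr (a := a) (b := b).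
- by move=> i; rewrite -ab coefZ dvdp_mulr.
- have [y [y0 sy yt]] := key _ _ _ _ ca la aE c0.
  by apply: (IH y e a' b) => //; apply: leq_trans szN; rewrite ltn_add2r.
- have [y [y0 sy yt]] := key _ _ _ _ eb lb bE e0.
  by apply: (IH c y a b') => //; apply: leq_trans szN; rewrite ltn_add2l.
Qed.

Section Weighted.
Variables (K : fieldType) (D : nat).
Implicit Types p q chi : {poly {poly K}}.

(* The degree in which 'X has weight D and the inner variable weight 1, plus 1. *)
Definition weight p : nat := sizeY (p \Po ('X^D *: 'X)).

Lemma weight_coef p i : (size (p`_i)%R + D * i <= weight p)%N \/ p`_i = 0.
Proof.
have [|pi0] := eqVneq p`_i 0; [by right|left].
have := max_size_coefXY (p \Po ('X^D *: 'X)) i.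
suff -> : (p \Po ('X^D *: 'X))`_i = p`_i * 'X^(D * i).
  by rewrite size_mulXn // addnC.
have -> : p \Po ('X^D *: 'X) = \poly_(j < size p) (p`_j * 'X^(D * j)).
  rewrite comp_polyE poly_def; apply: eq_bigr => j _.
  by rewrite exprZn scalerA -exprM.
by rewrite coef_poly; case: ltnP => // le; rewrite nth_default ?mul0r.
Qed.

Lemma weightM p q : p != 0 -> q != 0 -> weight (p * q) = (weight p + weight q).-1.
Proof.
move=> p0 q0; rewrite /weight comp_polyM !sizeYE rmorphM /= size_mul // swapXY_eq0.
all: rewrite comp_poly_eq0 // size_scale ?size_polyX // -size_poly_gt0 size_polyXn //.
Qed.

Lemma weight_monic p : p \is monic -> (D * (size p).-1 < weight p)%N.
Proof.
move=> pm; have [|] := weight_coef p (size p).-1; rewrite -lead_coefE (monicP pm).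
  by rewrite size_poly1.
by move/eqP; rewrite oner_eq0.
Qed.

(** The substitution behind [weight] multiplies X^n by the M-th power of the inner variable, so
    every entry of the characteristic matrix has degree at most M in that variable, and the
    determinant at most M d. *)
Lemma weight_char_poly d n M (W : 'M[{poly K}]_d) : (0 < n)%N -> M = (D * n)%N ->
  (forall i j, size (W i j) <= M.+1)%N ->
  (weight (char_poly W \Po 'X^n) <= (M * d).+1)%N.
Proof.
move=> n0 ME HW.
rewrite /weight -comp_polyA comp_Xn_poly exprZn -exprM -ME.
have -> : 'X^M *: 'X^n = ('X^M *: 'X) \Po 'X^n :> {poly {poly K}}.
  by rewrite comp_polyZ comp_polyX.
rewrite comp_polyA.
set u := _ \Po ('X^M *: 'X).
apply: (@leq_trans (sizeY u)).
  apply/bigmax_leqP => i _; rewrite coef_comp_poly_Xn //.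
  by case: ifP => _; rewrite ?size_poly0 // max_size_coefXY.
rewrite /u sizeYE /char_poly -(det_map_mx (comp_poly ('X^M *: 'X))) -det_map_mx.
apply: size_det_leq => i j; rewrite !mxE -sizeYE.
rewrite rmorphB rmorphMn /= comp_polyC comp_polyX.
apply/bigmax_leqP => -[k /= _] _; rewrite coefB coefMn coefZ coefX coefC.
apply: leq_trans (size_polyD _ _) _; rewrite geq_max size_polyN; apply/andP; split.
  case: (i == j); last by rewrite mulr0n size_poly0.
  rewrite mulr1n; case: (_ == 1)%N; last by rewrite mulr0 size_poly0.
  by rewrite mulr1 size_polyXn.
by case: (_ == 0)%N; rewrite ?size_poly0.
Qed.

(* Both factors being monic, neither can exceed its share of the weight. *)
Lemma size_coef_monic_dvd d n (W : 'M[{poly K}]_d) chi q : (0 < n)%N ->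
  (forall i j, size (W i j) <= (D * n).+1)%N ->
  chi \is monic -> char_poly W \Po 'X^n = chi * q ->
  forall i, (size (chi`_i)%R <= (D * (size chi).-1).+1)%N.
Proof.
move=> n0 HW chim pE i.
have pm : char_poly W \Po 'X^n \is monic.
  exact: comp_polyXn_monic n0 (char_poly_monic _).
have qm : q \is monic by rewrite -(monicMl _ chim) -pE.
have szp : size (char_poly W \Po 'X^n) = (d * n).+1.
  rewrite -[LHS]prednK ?size_poly_gt0 ?monic_neq0 // size_comp_poly.
  by rewrite size_char_poly size_polyXn.
case: (weight_coef chi i) => [h|->]; last by rewrite size_poly0.
have := weight_char_poly n0 (erefl _) HW.
have := weight_monic qm; have := weight_monic chim.
move: szp; rewrite pE size_mul ?monic_neq0 // weightM ?monic_neq0 //.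
move: (monic_neq0 chim) (monic_neq0 qm); rewrite -!size_poly_gt0 => a0 b0.
rewrite -(prednK a0) -(prednK b0) /=; move: h (_.-1) (_.-1) => h a b dE h1 h2.
have {}dE : (d * n = a + b)%N by move: dE; clear; lia.
have -> : (D * n * d = D * a + D * b)%N by rewrite -mulnA [(n * d)%N]mulnC dE mulnDr.
move: (weight chi) (weight q) (size _) (D * a)%N (D * b)%N (D * i)%N h h1 h2.
by clear; lia.
Qed.
End Weighted.

(** The cofactor [q] is explicit because [%|] over a ring that is not a field means divisibility up
    to a scalar only. *)
Definition bounded_root_polyX (K : fieldType) d r e (BB : seq 'M[{poly K}]_d.+1)
    (chi : {poly {poly K}}) : Prop :=
  [/\ chi \is monic, (size chi <= e.+1)%N &
    exists n ws q, [/\ (0 < n)%N, size ws = (r * n)%N, {subset ws <= BB} &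
      char_poly (\prod_(w <- ws) w) \Po 'X^n = chi * q]].

Lemma natr_inj_pchar0 (K : fieldType) : [pchar K] =i pred0 ->
  injective (fun n : nat => n%:R : K).
Proof.
move=> /pcharf0P K0 m n /eqP; wlog le : m n / (m <= n)%N.
  by move=> H; case: (leqP m n) => [/H//|/ltnW /H]; rewrite eq_sym => H' /H' ->.
rewrite eq_sym -subr_eq0 -natrB // K0 subn_eq0 => le'.
by apply/eqP; rewrite eqn_leq le.
Qed.

(** Interpolation: the weight bounds the degree of the coefficients in the inner variable, so [chi]
    is determined by its specialisations at N points, which are distinct in characteristic zero.
    Each specialisation satisfies [bounded_root_poly] over K and has finitely many possible
    values. *)
Lemma bounded_root_polyX_finite (K : fieldType) d r e (BB : seq 'M[{poly K}]_d.+1) :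
  [pchar K] =i pred0 -> northcott K ->
  finitely_many (bounded_root_polyX r e BB).
Proof.
move=> K0 NK.
have [D0 HD0] : exists D0, forall B, B \in BB -> forall i j, (size (B i j) <= D0.+1)%N.
  exists (\max_(B <- BB) \max_i \max_j size (B i j)) => B BBB i j.
  rewrite leqW //; apply: leq_trans (leq_bigmax_seq B BBB isT).
  by apply: leq_trans (leq_bigmax i); apply: leq_trans (leq_bigmax j).
(* A product of r n matrices has entries of degree at most D n. Then N bounds the size of each
   coefficient of [chi] and also serves as the number of evaluation points. *)
pose D := (D0 * r)%N; pose N := (D * e).+1.
pose ev (a : nat) : {poly K} -> K := horner_eval a%:R.
have [Lall HL] : exists L : seq {poly K}, forall a, (a < N)%N -> forall chi,
    bounded_root_poly r e (map (map_mx (ev a)) BB) chi -> chi \in L.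
  elim: N => [|N [L HL]]; first by exists [::].
  have [L' HL'] := NK d r e (map (map_mx (ev N)) BB).
  exists (L ++ L') => a; rewrite ltnS leq_eqVlt.
  case/orP=> [/eqP ->|aN] chi h; rewrite mem_cat; first by rewrite HL' ?orbT.
  by rewrite (HL a).
have deg chi : bounded_root_polyX r e BB chi -> forall i, (size (chi`_i)%R <= N)%N.
  move=> [chim szchi [n [ws [q [n0 sws sub pE]]]]] i.
  apply: leq_trans (size_coef_monic_dvd (D := D) n0 _ chim pE i) _.
    move=> k l; rewrite /D -mulnA -sws; apply: size_prod_mx_leq => B /sub.
    exact: HD0.
  by rewrite /N ltnS leq_mul2l -ltnS prednK ?szchi ?orbT // size_poly_gt0 monic_neq0.
apply: (@finitely_many_inj _ _ _
   (fun t : seq {poly K} => size t = N /\ {subset t <= Lall})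
   (fun chi => mkseq (fun a => map_poly (ev a) chi) N)); last exact: finitely_many_seqs.
  move=> chi [chim szchi [n [ws [q [n0 sws sub pE]]]]].
  split; first by rewrite size_mkseq.
  move=> u /(nthP 0)[a]; rewrite size_mkseq => aN <-; rewrite nth_mkseq //.
  apply: (HL a) => //; split; first exact: monic_map.
    by apply: leq_trans (size_poly _ _) szchi.
  exists n, (map (map_mx (ev a)) ws); split=> //; first by rewrite size_map.
    by move=> v /mapP[w /sub wB ->]; apply: map_f.
  rewrite big_map -rmorph_prod -map_char_poly -(map_polyXn (ev a)).
  by rewrite -map_comp_poly pE rmorphM /= dvdp_mulIl.
move=> p q pb qb pq; apply/polyP => i; apply/eqP; rewrite -subr_eq0; apply/eqP.
apply: (@roots_geq_poly_eq0 _ _ (mkseq (fun a => a%:R) N)).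
- apply/allP => u /mapP[a]; rewrite mem_iota add0n => /= aN ->.
  have := congr1 (fun t => t`_a) pq; rewrite !nth_mkseq // => /(congr1 (fun v : {poly K} => v`_i)).
  by rewrite !coef_map /= /ev /horner_eval rootE hornerD hornerN => ->; rewrite subrr.
- by rewrite mkseq_uniq //; exact: natr_inj_pchar0.
- rewrite size_mkseq (leq_trans (size_polyD _ _)) // geq_max size_polyN.
  by rewrite !deg.
Qed.

(** For monic [chi] and nonzero [M], the monic polynomial whose roots are M times those of [chi]. *)
Definition scale_roots (K : fieldType) (M : K) (chi : {poly K}) : {poly K} :=
  M ^+ (size chi).-1 *: (chi \Po (M^-1 *: 'X)).

Section ScaleRoots.
Variables (K : fieldType) (M : K) (chi : {poly K}).
Hypothesis M0 : M != 0.

Let szX (a : K) : a != 0 -> size (a *: 'X) = 2.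
Proof. by move=> a0; rewrite size_scale // size_polyX. Qed.

Lemma size_scale_roots : size (scale_roots M chi) = size chi.
Proof.
rewrite /scale_roots size_scale ?expf_neq0 // size_comp_poly2 // szX //.
by rewrite invr_eq0.
Qed.

Lemma scale_roots_monic : chi \is monic -> scale_roots M chi \is monic.
Proof.
move=> chim; rewrite monicE /scale_roots lead_coefZ lead_coef_comp ?szX ?invr_eq0 //.
rewrite (monicP chim) mul1r lead_coefZ lead_coefX mulr1 exprVn.
by rewrite mulfV // expf_neq0.
Qed.

Lemma scale_rootsK :
  M ^- (size chi).-1 *: (scale_roots M chi \Po (M *: 'X)) = chi.
Proof.
rewrite /scale_roots comp_polyZ scalerA mulVf ?expf_neq0 // scale1r -comp_polyA.
by rewrite comp_polyZ comp_polyX scalerA mulVf // scale1r comp_polyXr.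
Qed.

Lemma scale_roots_dvd d n (W : 'M[K]_d) :
  chi %| char_poly W \Po 'X^n ->
  scale_roots M chi %| char_poly (M ^+ n *: W) \Po 'X^n.
Proof.
move=> dv; rewrite char_poly_scale ?expf_neq0 //.
rewrite /scale_roots dvdpZl ?expf_neq0 // comp_polyZ dvdpZr ?expf_neq0 //.
rewrite -comp_polyA comp_polyZ comp_polyX.
have -> : (M ^+ n)^-1 *: 'X^n = 'X^n \Po (M^-1 *: 'X).
  by rewrite comp_Xn_poly exprZn exprVn.
by rewrite comp_polyA; apply: dvdp_comp_poly.
Qed.
End ScaleRoots.

(** With m a common denominator of the matrices, scaling the roots by m^r turns the product of r n
    matrices into one over K[X]. By Gauss's lemma the scaled polynomial has its coefficients in
    K[X], where finiteness is known, and the scaling can be undone. *)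
Lemma northcott_fraction (K : fieldType) : [pchar K] =i pred0 ->
  northcott K -> northcott {fraction {poly K}}.
Proof.
move=> K0 NK d r e BB.
have [m m0 Hm] := @seq_common_denominator {poly K}
  [seq B ij.1 ij.2 | B : 'M_d.+1 <- BB, ij : 'I_d.+1 * 'I_d.+1 <- enum predT].
set mF := tofrac m in Hm.
have mF0 : mF != 0 by rewrite tofrac_eq0.
have HmB B : B \in BB -> exists B', mF *: B = map_mx (@tofrac _) B'.
  move=> BBB; have h i j : exists a, mF * B i j == tofrac a.
    have [|a ->] := Hm (B i j); last by exists a.
    by apply/allpairsP; exists (B, (i, j)); rewrite mem_enum.
  exists (\matrix_(i, j) xchoose (h i j)); apply/matrixP => i j.
  by rewrite !mxE; apply/eqP; exact: (xchooseP (h i j)).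
have [num Hnum] : exists num : 'M_d.+1 -> 'M[{poly K}]_d.+1,
    forall B, B \in BB -> mF *: B = map_mx (@tofrac _) (num B).
  have : forall B, exists B', B \in BB -> mF *: B = map_mx (@tofrac _) B'.
    move=> B; have [/HmB[B' E]|] := boolP (B \in BB); first by exists B'.
    by exists 0.
  by case/choice => num Hnum; exists num.
pose M := mF ^+ r; have M0 : M != 0 by rewrite expf_neq0.
apply: (@finitely_many_image _ _ (bounded_root_polyX r e (map num BB)) _
  (fun chi => M ^- (size chi).-1 *: (map_poly (@tofrac _) chi \Po (M *: 'X))));
  last exact: bounded_root_polyX_finite.
move=> chi [chim szchi [n [ws [n0 sws sub dv]]]].
pose chi1 := scale_roots M chi.
have sz1 : size chi1 = size chi := size_scale_roots chi M0.
have chi1m : chi1 \is monic by apply: scale_roots_monic.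
have WE : map_mx (@tofrac _) (\prod_(w <- map num ws) w) = M ^+ n *: \prod_(w <- ws) w.
  rewrite rmorph_prod big_map (eq_big_seq (fun w => mF *: w)).
    by rewrite scale_prod sws exprM.
  by move=> w /sub /Hnum ->.
have dv1 : chi1 %| map_poly (@tofrac _) (char_poly (\prod_(w <- map num ws) w) \Po 'X^n).
  by rewrite map_comp_poly map_polyXn map_char_poly WE; apply: scale_roots_dvd.
have pm : char_poly (\prod_(w <- map num ws) w) \Po 'X^n \is monic.
  exact: comp_polyXn_monic n0 (char_poly_monic _).
have [chi' [q' [E E']]] := monic_dvd_integral pm chi1m dv1.
have tinj : injective (@tofrac {poly K}) by move=> x y /eqP; rewrite tofrac_eq => /eqP.
have szE : size chi' = size chi.
  by rewrite -sz1 E size_map_inj_poly.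
exists chi'.
  split.
  - rewrite monicE; apply/eqP/tinj; rewrite -(lead_coef_map_inj tinj (rmorph0 _)) -E.
    by rewrite (monicP chi1m) tofrac1.
  - by rewrite szE.
  exists n, (map num ws), q'; split => //; first by rewrite size_map.
  by move=> v /mapP[w /sub wB ->]; apply: map_f.
rewrite -E szE; exact: scale_rootsK.
Qed.

(** * Fields of fractions, subfields and simple extensions *)

Section FractionLift.
Variables (R : idomainType) (Q F : fieldType).
Variables (j : {rmorphism R -> Q}) (f : {rmorphism R -> F}).
Hypotheses (j_inj : injective j) (f_inj : injective f).
Hypothesis jP : forall x, exists n d, d != 0 /\ x * j d = j n.

(** Stated for any field of fractions [Q] of [R], since it serves both for [rat] over [int] and for
    K(X) over K[X]. *)
Lemma fraction_lift : exists g : {rmorphism Q -> F}, forall r, g (j r) = f r.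
Proof.
have /choice[nd ndP] : forall x, exists nd : R * R, nd.2 != 0 /\ x * j nd.2 = j nd.1.
  by move=> x; have [n [d h]] := jP x; exists (n, d).
have j0 d : d != 0 -> j d != 0 by rewrite -(rmorph0 j) (inj_eq j_inj).
have f0 d : d != 0 -> f d != 0 by rewrite -(rmorph0 f) (inj_eq f_inj).
pose g x := f (nd x).1 / f (nd x).2.
have gE x n d : d != 0 -> x * j d = j n -> g x = f n / f d.
  move=> d0 xd; have [d'0 xd'] := ndP x; rewrite /g.
  apply/eqP; rewrite eqr_div ?f0 // -!rmorphM; apply/eqP; congr (f _).
  apply: j_inj; rewrite !rmorphM -xd -xd' mulrAC; ring.
have gB : zmod_morphism g.
  move=> x y; have [dx0 xd] := ndP x; have [dy0 yd] := ndP y.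
  rewrite (gE _ ((nd x).1 * (nd y).2 - (nd y).1 * (nd x).2) ((nd x).2 * (nd y).2)).
  - rewrite rmorphB !rmorphM /g; field; by rewrite !f0.
  - by rewrite mulf_neq0.
  - rewrite rmorphB !rmorphM -xd -yd; ring.
have gM : monoid_morphism g.
  split=> [|x y].
    by rewrite (gE 1 1 1) ?oner_neq0 ?rmorph1 ?divr1 // mul1r.
  have [dx0 xd] := ndP x; have [dy0 yd] := ndP y.
  rewrite (gE _ ((nd x).1 * (nd y).1) ((nd x).2 * (nd y).2)).
  - rewrite !rmorphM /g; field; by rewrite !f0.
  - by rewrite mulf_neq0.
  - rewrite !rmorphM -xd -yd; ring.
pose gz := GRing.isZmodMorphism.Build Q F g gB.
pose gm := GRing.isMonoidMorphism.Build Q F g gM.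
pose G : {rmorphism Q -> F} := HB.pack g gz gm.
exists G => r /=; rewrite (gE _ r 1) ?oner_neq0 //.
  by rewrite rmorph1 divr1.
by rewrite rmorph1 mulr1.
Qed.
End FractionLift.

Section SubfieldType.
Variables (F : fieldType) (S : divringClosed F).
Definition subfield_type := {x | x \in S}.
HB.instance Definition _ := SubChoice.on subfield_type.
HB.instance Definition _ := [SubChoice_isSubComUnitRing of subfield_type by <:].
HB.instance Definition _ := [SubComUnitRing_isSubIntegralDomain of subfield_type by <:].
HB.instance Definition _ := [SubIntegralDomain_isSubField of subfield_type by <:].
End SubfieldType.

(** Subfields occur as sets, whereas polynomials and matrices over them need a field type; this
    passes from one to the other. *)
Lemma subfield_typeP (F : fieldType) (S : set F) : subfield S ->
  exists (K : fieldType) (iota : {rmorphism K -> F}),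
    forall x, S x <-> exists c, x = iota c.
Proof.
move=> [S1 SB SM SV].
pose P : {pred F} := fun x => `[< S x >].
have Pc : divring_closed P.
  split; first exact/asboolP.
    by move=> x y /asboolP Sx /asboolP Sy; apply/asboolP/SB.
  by move=> x y /asboolP Sx /asboolP Sy; apply/asboolP/SM => //; apply: SV.
pose h := GRing.isDivringClosed.Build F P Pc.
pose D : divringClosed F := HB.pack P h.
exists (subfield_type D), (val : {rmorphism subfield_type D -> F}) => x; split.
  by move=> Sx; have xD : x \in D; [exact/asboolP | exists (exist _ x xD)].
by case=> -[y yD] ->; apply/asboolP; exact: yD.
Qed.

(** Gives the dimension the literal form of a successor, in which square matrices form a nontrivial
    ring. *)
Lemma companion_exists (K : fieldType) (f : {poly K}) e :
  f \is monic -> size f = e.+2 -> exists C : 'M[K]_e.+1, char_poly C = f.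
Proof.
move=> fm szf; have := companionmxK fm; move: (companionmx f).
have -> : (size f).-1 = e.+1 by rewrite szf.
by move=> C CE; exists C.
Qed.

Section Adjoin.
Variables (K F : fieldType) (iota : {rmorphism K -> F}).
Implicit Types (x t : F) (p q mu : {poly K}).

Definition adjoin t : set F := [set x | exists p, x = (map_poly iota p).[t]].

Definition is_minpoly t mu : Prop :=
  [/\ mu \is monic, root (map_poly iota mu) t &
      forall p, root (map_poly iota p) t -> mu %| p].

Lemma minpoly_exists t : algebraicOver iota t -> exists mu, is_minpoly t mu.
Proof.
case=> p0 p00 p0t.
have ex : exists n, `[< exists p, [/\ p != 0, root (map_poly iota p) t & size p = n] >].
  by exists (size p0); apply/asboolP; exists p0.
have [n /asboolP[p [pn0 pt szp]] nmin] := ex_minnP ex.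
have l0 : (lead_coef p)^-1 != 0 by rewrite invr_eq0 lead_coef_eq0.
have mt : root (map_poly iota ((lead_coef p)^-1 *: p)) t.
  by rewrite linearZ /= rootZ // fmorph_eq0.
exists ((lead_coef p)^-1 *: p); split => //.
  by rewrite monicE lead_coefZ mulVf // lead_coef_eq0.
move=> q qt; rewrite dvdpZl // /dvdp; apply: contraTT isT => r0.
have : (n <= size (q %% p)%R)%N.
  apply: nmin; apply/asboolP; exists (q %% p); split=> //.
  move: qt; rewrite {1}(divp_eq q p) rmorphD rmorphM /= !rootE hornerD hornerM.
  by rewrite (rootP pt) mulr0 add0r.
by rewrite -szp leqNgt ltn_modp pn0.
Qed.

Lemma minpoly_size_gt1 t mu : is_minpoly t mu -> (1 < size mu)%N.
Proof.
case=> mum mut _; rewrite ltnNge; apply/negP => /size1_polyC.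
move: (mu`_0) => c mE; move: mum mut; rewrite mE monicE lead_coefC => /eqP ->.
by rewrite map_polyC /= rmorph1 rootC oner_eq0.
Qed.

(** The gcd does not vanish at t, so its cofactor in [mu] does, and minimality leaves only a
    constant gcd. *)
Lemma minpoly_coprime t mu p : is_minpoly t mu ->
  ~~ root (map_poly iota p) t -> coprimep p mu.
Proof.
move=> mumin pt; have [mum mut mud] := mumin.
have dt : ~~ root (map_poly iota (gcdp p mu)) t.
  by apply: contra pt; apply: root_dvdp; rewrite dvdp_map dvdp_gcdl.
have /dvdpP[q muE] := dvdp_gcdr p mu.
have qt : root (map_poly iota q) t.
  by move: mut; rewrite {1}muE rmorphM rootM (negPf dt) orbF.
have mu0 : mu != 0 := monic_neq0 mum.
have := mud _ qt; have q0 : q != 0.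
  by apply: contraNneq mu0 => q0; rewrite muE q0 mul0r.
have g0 : gcdp p mu != 0 by rewrite gcdp_eq0 negb_and mu0 orbT.
move/dvdp_leq => /(_ q0); rewrite {1}muE size_mul // /coprimep.
move: q0 g0; rewrite -!size_poly_gt0.
by move: (size q) (size (gcdp p mu)) => u v; lia.
Qed.

Lemma adjoinB t x y : adjoin t x -> adjoin t y -> adjoin t (x - y).
Proof. by move=> [p ->] [q ->]; exists (p - q); rewrite rmorphB hornerD hornerN. Qed.

Lemma adjoinM t x y : adjoin t x -> adjoin t y -> adjoin t (x * y).
Proof. by move=> [p ->] [q ->]; exists (p * q); rewrite rmorphM hornerM. Qed.

Lemma adjoin_const t c : adjoin t (iota c).
Proof. by exists c%:P; rewrite map_polyC hornerC. Qed.

Lemma adjoin_gen t : adjoin t t.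
Proof. by exists 'X; rewrite map_polyX hornerX. Qed.

Lemma adjoin_subfield t : algebraicOver iota t -> subfield (adjoin t).
Proof.
move=> /minpoly_exists[mu mumin]; split.
- by rewrite -(rmorph1 iota); exact: adjoin_const.
- exact: adjoinB.
- exact: adjoinM.
move=> _ [p ->]; have [pt|pt] := boolP (root (map_poly iota p) t).
  by rewrite (rootP pt) invr0 -(rmorph0 iota); exact: adjoin_const.
have [mum mut _] := mumin.
have /Bezout_eq1_coprimepP[[u v] /= uv] := minpoly_coprime mumin pt.
exists u; apply: (mulIf (x := (map_poly iota p).[t])); first exact: pt.
rewrite mulVf; last exact: pt.
have := congr1 (fun q => (map_poly iota q).[t]) uv.
rewrite rmorphD !rmorphM rmorph1 /= hornerD !hornerM (rootP mut) mulr0 addr0.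
by rewrite hornerC => ->.
Qed.

(* Multiplication by an element of K[t], in the basis of powers of t. *)
Lemma adjoin_rep t mu : is_minpoly t mu ->
  exists e (psi : F -> 'M[K]_e.+1),
  [/\ size mu = e.+2,
      forall x y, adjoin t x -> adjoin t y -> psi (x - y) = psi x - psi y,
      forall x y, adjoin t x -> adjoin t y -> psi (x * y) = psi x * psi y &
      forall c, psi (iota c) = c%:M].
Proof.
move=> mumin; have [mum mut mud] := mumin.
have mu1 := minpoly_size_gt1 mumin.
have [e szmu] : exists e, size mu = e.+2.
  by case: (size mu) mu1 => [|[|e]] // _; exists e.
have [C CE] := companion_exists mum szmu.
have /choice[P PP] : forall x, exists p, adjoin t x -> x = (map_poly iota p).[t].
  move=> x; have [[p xp]|nx] := pselect (adjoin t x); first by exists p.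
  by exists 0 => /nx.
(* Two polynomials with the same value at t differ by a multiple of [mu], which kills its companion
   matrix [C]; the choice of [P] is therefore immaterial. *)
have key p q : (map_poly iota p).[t] = (map_poly iota q).[t] ->
    horner_mx C p = horner_mx C q.
  move=> pq; have /mud/dvdpP[r rE] : root (map_poly iota (p - q)) t.
    by rewrite rootE rmorphB hornerD hornerN pq subrr.
  apply/eqP; rewrite -subr_eq0 -rmorphB rE rmorphM /= -CE Cayley_Hamilton.
  by rewrite mulr0.
exists e, (fun x => horner_mx C (P x)); split=> // [x y xt yt|x y xt yt|c].
- rewrite -rmorphB; apply: key.
  by rewrite -(PP _ (adjoinB xt yt)) rmorphB hornerD hornerN -!PP.
- rewrite -rmorphM; apply: key.
  by rewrite -(PP _ (adjoinM xt yt)) rmorphM hornerM -!PP.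
- rewrite -(horner_mx_C C); apply: key.
  by rewrite -(PP _ (adjoin_const t c)) map_polyC hornerC.
Qed.

Section Rep.
Variables (t : F) (e : nat) (psi : F -> 'M[K]_e.+1).
Hypothesis psiB : forall x y, adjoin t x -> adjoin t y -> psi (x - y) = psi x - psi y.
Hypothesis psiM : forall x y, adjoin t x -> adjoin t y -> psi (x * y) = psi x * psi y.
Hypothesis psiC : forall c, psi (iota c) = c%:M.

Lemma adjoin_rep0 : psi 0 = 0. Proof. by rewrite -(rmorph0 iota) psiC raddf0. Qed.
Lemma adjoin_rep1 : psi 1 = 1. Proof. by rewrite -(rmorph1 iota) psiC. Qed.

Lemma adjoin0 : adjoin t 0. Proof. by rewrite -(rmorph0 iota); exact: adjoin_const. Qed.
Lemma adjoin1 : adjoin t 1. Proof. by rewrite -(rmorph1 iota); exact: adjoin_const. Qed.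

Lemma adjoinD x y : adjoin t x -> adjoin t y -> adjoin t (x + y).
Proof.
move=> xt yt; rewrite -[y]opprK -[- y]sub0r.
by apply: adjoinB => //; apply: adjoinB => //; exact: adjoin0.
Qed.

Lemma adjoin_repD x y : adjoin t x -> adjoin t y -> psi (x + y) = psi x + psi y.
Proof.
move=> xt yt; have yt' : adjoin t (0 - y) by apply: adjoinB => //; exact: adjoin0.
have -> : x + y = x - (0 - y) by rewrite sub0r opprK.
by rewrite psiB // psiB ?adjoin_rep0 ?sub0r ?opprK //; exact: adjoin0.
Qed.

Lemma adjoinX x n : adjoin t x -> adjoin t (x ^+ n).
Proof.
move=> xt; elim: n => [|n IH]; first exact: adjoin1.
by rewrite exprS; exact: adjoinM.
Qed.

Lemma adjoin_repX x n : adjoin t x -> psi (x ^+ n) = psi x ^+ n.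
Proof.
move=> xt; elim: n => [|n IH]; first by rewrite !expr0 adjoin_rep1.
by rewrite !exprS psiM ?IH //; exact: adjoinX.
Qed.

Lemma adjoin_horner x p : adjoin t x -> adjoin t (map_poly iota p).[x].
Proof.
move=> xt; elim/poly_ind: p => [|p c IH].
  by rewrite rmorph0 horner0; exact: adjoin0.
rewrite rmorphD rmorphM /= map_polyX map_polyC hornerMXaddC.
by apply: adjoinD; [exact: adjoinM | exact: adjoin_const].
Qed.

Lemma adjoin_rep_horner x p : adjoin t x ->
  psi (map_poly iota p).[x] = horner_mx (psi x) p.
Proof.
move=> xt; elim/poly_ind: p => [|p c IH].
  by rewrite !rmorph0 horner0 adjoin_rep0.
rewrite !rmorphD !rmorphM /= map_polyX map_polyC hornerMXaddC horner_mx_X horner_mx_C.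
rewrite adjoin_repD ?psiM ?psiC ?IH //; first exact: adjoin_horner.
  by apply: adjoinM => //; exact: adjoin_horner.
exact: adjoin_const.
Qed.

Lemma adjoin_rep_inj x : algebraicOver iota t -> adjoin t x -> psi x = 0 -> x = 0.
Proof.
move=> talg xt px; apply/eqP; apply: contraTT isT => x0.
have [_ _ _ SV] := adjoin_subfield talg.
have := oner_neq0 ('M[K]_e.+1 : nzRingType).
rewrite -adjoin_rep1 -(mulfV x0) psiM ?px ?mul0r ?eqxx //.
exact: SV.
Qed.

Lemma adjoin_rep_prod (I : Type) (r : seq I) (f : I -> F) : (forall i, adjoin t (f i)) ->
  psi (\prod_(i <- r) f i) = \prod_(i <- r) psi (f i) /\ adjoin t (\prod_(i <- r) f i).
Proof.
move=> ft; elim: r => [|i r [IH1 IH2]].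
  by rewrite !big_nil adjoin_rep1; split=> //; exact: adjoin1.
by rewrite !big_cons psiM ?IH1 //; split=> //; exact: adjoinM.
Qed.

End Rep.
End Adjoin.

Lemma primitive_element_seq (K F : fieldType) (iota : {rmorphism K -> F}) (s : seq F) :
  [pchar K] =i pred0 -> (forall x, x \in s -> algebraicOver iota x) ->
  exists2 t, algebraicOver iota t & forall x, x \in s -> adjoin iota t x.
Proof.
move=> K0; elim: s => [|x s IH] alg.
  by exists 0 => //; exact: algebraic0.
have [|t talg ts] := IH; first by move=> y ys; apply: alg; rewrite inE ys orbT.
have xalg := alg x (mem_head _ _).
have [[p p0 px] [q q0 qt]] := (xalg, talg).
have [n [[u ux] [v vt]]] := pchar0_PET p0 px q0 qt K0.
exists (t *+ n - x).
  apply: algebraic_sub => //; rewrite -mulr_natr; apply: algebraic_mul => //.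
  by rewrite -(rmorph_nat iota); exact: algebraic_id.
move=> y; rewrite inE => /orP[/eqP ->|/ts[w ->]]; first by exists u.
by exists (w \Po v); rewrite map_comp_poly horner_comp vt.
Qed.

(** * Finiteness of radicals *)

Lemma rat_rmorphism (F : fieldType) : [pchar F] =i pred0 ->
  exists g : {rmorphism rat -> F}, True.
Proof.
move=> F0; have [||x|g _] := @fraction_lift int rat F intr intr; last by exists g.
- exact: intr_inj.
- move=> x y /eqP; rewrite -subr_eq0 -rmorphB => xy; apply/eqP; rewrite -subr_eq0.
  have /pcharf0P nF := F0; move: xy; case: (x - y) => n /=.
    by rewrite -pmulrn nF => /eqP ->.
  by rewrite NegzE mulrNz oppr_eq0 -pmulrn nF.
- by exists (numq x), (denq x); split; [exact: denq_neq0 | exact/esym/numqE].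
Qed.

Lemma pchar0_rmorph (K L : fieldType) (f : {rmorphism K -> L}) :
  [pchar L] =i pred0 -> [pchar K] =i pred0.
Proof. by move=> L0 p; rewrite -(fmorph_pchar f) L0. Qed.

(** The elements of [s] are treated one by one: if x is transcendental over the field reached so
    far, a variable mapped to x is added, otherwise the field stays the same. *)
Lemma northcott_cover (F : fieldType) (s : seq F) : [pchar F] =i pred0 ->
  exists (K : fieldType) (iota : {rmorphism K -> F}),
    northcott K /\ forall x, x \in s -> algebraicOver iota x.
Proof.
move=> F0; elim: s => [|x s [K [iota [NK alg]]]].
  by have [g _] := rat_rmorphism F0; exists rat, g; split=> //; exact: northcott_rat.
have [xalg|xtr] := pselect (algebraicOver iota x).
  by exists K, iota; split=> // y; rewrite inE => /orP[/eqP ->|/alg].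
pose ev : {rmorphism {poly K} -> F} := horner_eval x \o map_poly iota.
have ev_inj : injective ev.
  move=> p q pq; apply/eqP; rewrite -subr_eq0; apply: contraTT isT => pq0.
  case: xtr; exists (p - q) => //; rewrite rootE rmorphB /= hornerD hornerN.
  by move: pq; rewrite /ev /= /horner_eval => ->; rewrite subrr.
have tinj : injective (@tofrac {poly K}) by move=> p q /eqP; rewrite tofrac_eq => /eqP.
have [g gE] := fraction_lift tinj ev_inj (@fractionP _).
exists {fraction {poly K}}, g; split.
  by apply: northcott_fraction => //; exact: pchar0_rmorph iota F0.
move=> y; rewrite inE => /orP[/eqP ->|/alg[p p0 py]].
  have -> : x = g (tofrac 'X) by rewrite gE /ev /= map_polyX /horner_eval hornerX.
  exact: algebraic_id.
exists (map_poly (@tofrac _ \o polyC) p).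
  by rewrite map_poly_eq0.
rewrite -map_poly_comp (eq_map_poly (g := iota)) // => c /=.
by rewrite gE /ev /= map_polyC /horner_eval hornerC.
Qed.

Lemma roots_finite (F : fieldType) (p : {poly F}) : p != 0 ->
  finitely_many (fun x => root p x).
Proof.
have [n] := ubnP (size p); elim: n p => // n IH p; rewrite ltnS => szp p0.
have [[x px]|nx] := pselect (exists x, root p x); last first.
  by exists [::] => x px; case: nx; exists x.
have /factor_theorem[q pE] := px.
have q0 : q != 0 by apply: contraNneq p0 => q0; rewrite pE q0 mul0r.
have [|//|s Hs] := IH q.
  by move: szp; rewrite pE size_Mmonic ?monicXsubC // size_XsubC addn2.
exists (x :: s) => y; rewrite pE rootM root_XsubC inE => /orP[/Hs ->|->//].
by rewrite orbT.
Qed.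

Lemma finitely_many_bigcup (T U : eqType) (s : seq U) (A : U -> T -> Prop) :
  (forall u, u \in s -> finitely_many (A u)) ->
  finitely_many (fun x => exists2 u, u \in s & A u x).
Proof.
elim: s => [|u s IH] H; first by exists [::] => x [].
have [|l Hl] := IH; first by move=> v vs; apply: H; rewrite inE vs orbT.
have [l' Hl'] := H u (mem_head _ _).
exists (l' ++ l) => x [v]; rewrite inE mem_cat => /orP[/eqP -> /Hl' -> //|vs Av].
by rewrite Hl ?orbT //; exists v.
Qed.

Definition field_gen (F : fieldType) (s : seq F) : set F :=
  [set x | forall S, subfield S -> (forall y, y \in s -> S y) -> S x].

Lemma field_gen_subfield (F : fieldType) (s : seq F) : subfield (field_gen s).
Proof.
split=> [|x y xs ys|x y xs ys|x xs] S SS sS; have [S1 SB SM SV] := SS => //.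
- by apply: SB; [apply: xs | apply: ys].
- by apply: SM; [apply: xs | apply: ys].
- by apply: SV; apply: xs.
Qed.

Lemma horner_mx_compXn (R : comNzRingType) d (A : 'M[R]_d.+1) (p : {poly R}) n :
  horner_mx A (p \Po 'X^n) = horner_mx (A ^+ n) p.
Proof.
elim/poly_ind: p => [|p c IH]; first by rewrite comp_poly0 !rmorph0.
rewrite comp_poly_MXaddC !rmorphD !rmorphM /= IH !horner_mx_C horner_mx_X.
by rewrite rmorphXn /= horner_mx_X.
Qed.

(** The generated field lies in some K[t], represented by matrices over K through [psi]. Since
    psi(y)^n is the product of the psi(h_i)^(b_i), the minimal polynomial of y divides the
    characteristic polynomial of that product taken at X^n; its degree is at most that of t. So it
    belongs to a finite list, and y is one of the roots. *)
Lemma isolator_finite (F : fieldType) (s hs : seq F) : [pchar F] =i pred0 ->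
  (forall h, h \in hs -> field_gen s h) ->
  finitely_many (fun y => field_gen s y /\ exists n (b : 'I_(size hs) -> nat),
     [/\ (0 < n)%N, forall i, (b i <= n)%N &
         y ^+ n = \prod_(i < size hs) hs`_i ^+ b i]).
Proof.
move=> F0 hsS; have [K [iota [NK alg]]] := northcott_cover s F0.
have K0 := pchar0_rmorph iota F0.
have [t talg ts] := primitive_element_seq K0 alg.
have gen_t x : field_gen s x -> adjoin iota t x.
  by apply => //; exact: adjoin_subfield.
have [mu mumin] := minpoly_exists talg.
have [e [psi [szmu psiB psiM psiC]]] := adjoin_rep mumin.
pose BB := 1 :: map psi hs; pose r := size hs.
have [L HL] := NK e r e.+1 BB.
have [ys Hys] : finitely_many (fun y => exists2 chi : {poly K},
    chi \in [seq chi <- L | chi != 0] & root (map_poly iota chi) y).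
  apply: finitely_many_bigcup => chi; rewrite mem_filter => /andP[chi0 _].
  by apply: roots_finite; rewrite map_poly_eq0.
exists ys => y [ygen [n [b [n0 bn yn]]]]; apply: Hys.
have yt := gen_t y ygen.
have annih p : horner_mx (psi y) p = 0 -> root (map_poly iota p) y.
  move=> py; rewrite rootE; apply/eqP; apply: (adjoin_rep_inj psiM psiC talg).
    exact: adjoin_horner.
  by rewrite (adjoin_rep_horner psiB psiM psiC).
have charE := annih _ (Cayley_Hamilton (psi y)).
have c0 : char_poly (psi y) != 0 := monic_neq0 (char_poly_monic _).
have yalg : algebraicOver iota y by exists (char_poly (psi y)).
have [chi [chim chiy chid]] := minpoly_exists yalg.
exists chi => //; rewrite mem_filter (monic_neq0 chim) /=; apply: HL.
have ht i : adjoin iota t hs`_i.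
  have [ir|ir] := ltnP i r; last by rewrite nth_default //; exact: adjoin0.
  exact: gen_t (hsS _ (mem_nth 0 ir)).
split=> //.
  by rewrite -(size_char_poly (psi y)); apply: dvdp_leq => //; exact: chid.
(* Each i contributes [b i] copies of its matrix and [n - b i] identities, which makes r n factors
   in all. *)
exists n, (flatten [seq nseq (b i) (psi hs`_i) ++ nseq (n - b i) 1 | i <- enum 'I_r]).
split=> //.
- rewrite size_flatten /shape -map_comp (eq_map (g := fun=> n)).
    by rewrite sumnE big_map big_const_seq count_predT size_enum_ord iter_addn_0 mulnC.
  by move=> i /=; rewrite size_cat !size_nseq subnKC.
- move=> B /flattenP[l /mapP[i _ ->]]; rewrite mem_cat !mem_nseq.
  case/orP=> /andP[_ /eqP ->]; last exact: mem_head.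
  by rewrite inE map_f ?orbT // mem_nth.
apply: chid; apply: annih.
have [prodE _] := adjoin_rep_prod psiM psiC (enum 'I_r) (fun i => adjoinX (b i) (ht i)).
have -> : \prod_(w <- flatten [seq nseq (b i) (psi hs`_i) ++ nseq (n - b i) 1 | i <- enum 'I_r]) w
   = psi y ^+ n.
  rewrite -(adjoin_repX psiM psiC) // yn -big_enum /= prodE big_flatten big_map.
  apply: eq_bigr => i _; rewrite big_cat /= !big_nseq !iter_mulr_1 expr1n mulr1.
  by rewrite (adjoin_repX psiM psiC).
by rewrite horner_mx_compXn Cayley_Hamilton.
Qed.

(** * Minimal polynomials of radicals *)

Lemma horner_mx_dvd (K : fieldType) e (C : 'M[K]_e.+1) (p : {poly K}) :
  char_poly C %| p -> horner_mx C p = 0.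
Proof. by move=> /dvdpP[q ->]; rewrite rmorphM /= Cayley_Hamilton mulr0. Qed.

Lemma horner_mx_XnsubC (K : fieldType) e (C : 'M[K]_e.+1) n b :
  horner_mx C ('X^n - b%:P) = C ^+ n - b%:M.
Proof. by rewrite rmorphB rmorphXn /= horner_mx_X horner_mx_C. Qed.

Lemma coprime_power_root (K : fieldType) (u w : K) m p : u != 0 ->
  (0 < m)%N -> coprime m p -> w ^+ p = u ^+ m -> exists c, c ^+ p = u.
Proof.
move=> u0 m0 cop wu; have [a b ab _] := egcdnP p m0.
exists (w ^+ a / u ^+ b); rewrite expr_div_n -!exprM mulnC exprM wu -exprM mulnC ab.
by rewrite (eqP cop) exprD expr1 mulrAC mulfV ?mul1r // expf_neq0.
Qed.

(* The determinant of the companion matrix of a factor of degree m is a p-th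
   root of u ^+ m. *)
Lemma XpsubC_factor (K : fieldType) p (u : K) (f : {poly K}) :
  prime p -> u != 0 -> f \is monic -> f %| 'X^p - u%:P ->
  (1 < size f <= p)%N -> exists c, c ^+ p = u.
Proof.
move=> pp u0 fm fd /andP[f1 fp].
have [e szf] : exists e, size f = e.+2 by case: (size f) f1 => [|[|e]] // _; exists e.
have [C CE] := companion_exists fm szf.
have /eqP : horner_mx C ('X^p - u%:P) = 0 by apply: horner_mx_dvd; rewrite CE.
rewrite horner_mx_XnsubC subr_eq0 => /eqP Cp.
apply: (@coprime_power_root _ u (\det C) e.+1) => //.
  rewrite coprime_sym prime_coprime //; apply/negP => /(dvdn_leq (ltn0Sn e)).
  by rewrite leqNgt -ltnS -szf ltnS fp.
have <- : \det (u%:M : 'M_e.+1) = u ^+ e.+1 by exact: det_scalar.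
rewrite -Cp; elim: (p) => [|k IH]; first by rewrite !expr0 det1.
by rewrite !exprS -mulmxE det_mulmx IH.
Qed.

(** Sorting the exponents by their residue modulo p writes r(g) as a polynomial in g of degree below
    p with coefficients in K[g^p]. *)
Lemma sum_poly_split (K : fieldType) (F : fieldType) (iota : {rmorphism K -> F})
    p P (r : {poly K}) (g : F) : (size r <= P * p)%N ->
  (map_poly iota r).[g] =
  \sum_(j < p) (map_poly iota (\poly_(i < P) r`_(i * p + j))).[g ^+ p] * g ^+ j.
Proof.
move=> szr.
rewrite (@horner_coef_wide _ (P * p)); last by rewrite (leq_trans (size_poly _ _)).
transitivity (\sum_(0 <= i < P * p) iota r`_i * g ^+ i).
  by rewrite big_mkord; apply: eq_bigr => i _; rewrite coef_map.
rewrite big_nat_mul big_mkord.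
transitivity (\sum_(i < P) \sum_(j < p) iota r`_(i * p + j) * g ^+ (i * p + j)).
  apply: eq_bigr => i _; rewrite -{1}[(i * p)%N]add0n big_addn mulSn addnK big_mkord.
  by apply: eq_bigr => j _; rewrite addnC.
rewrite exchange_big; apply: eq_bigr => j _ /=.
rewrite (@horner_coef_wide _ P); last by rewrite (leq_trans (size_poly _ _)) // size_poly.
rewrite mulr_suml; apply: eq_bigr => i _.
by rewrite coef_map coef_poly ltn_ord exprD -mulrA -exprM mulnC.
Qed.

Lemma is_minpolyI (K F : fieldType) (iota : {rmorphism K -> F}) (g : F) (mu : {poly K}) :
  mu \is monic -> root (map_poly iota mu) g ->
  (forall r : {poly K}, (size r < size mu)%N -> root (map_poly iota r) g -> r = 0) ->
  is_minpoly iota g mu.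
Proof.
move=> mum mug H; split=> // p pg; apply/modp_eq0P/H.
  by rewrite ltn_modp monic_neq0.
move: pg; rewrite {1}(divp_eq p mu) rmorphD rmorphM /= !rootE hornerD hornerM.
by rewrite (rootP mug) mulr0 add0r.
Qed.

Lemma minpoly_small (K F : fieldType) (iota : {rmorphism K -> F}) (g : F) (mu r : {poly K}) :
  is_minpoly iota g mu -> (size r < size mu)%N -> root (map_poly iota r) g -> r = 0.
Proof.
case=> _ _ mud szr /mud; apply: contraTeq => r0; apply/negP => /dvdp_leq.
by rewrite r0 => /(_ isT); rewrite leqNgt szr.
Qed.

Lemma root_XnsubC (K F : fieldType) (iota : {rmorphism K -> F}) (g : F) n b :
  root (map_poly iota ('X^n - b%:P)) g = (g ^+ n == iota b).
Proof.
rewrite rmorphB /= map_polyXn map_polyC rootE.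
by rewrite hornerD hornerN hornerXn hornerC subr_eq0.
Qed.

(** A form of Capelli's criterion; for p = 2, that -b is not a square rules out the exceptional b =
    -4 c^4. By induction u = g^p has minimal polynomial X^P - b. As u is not a p-th power in K(u), g
    has degree p over K(u), and [sum_poly_split] combines the two steps of the tower. *)
Lemma prime_power_minpoly (K F : fieldType) (iota : {rmorphism K -> F}) (p s : nat) b (g : F) :
  prime p -> b != 0 -> g ^+ (p ^ s) = iota b ->
  (forall c, c ^+ p != b) -> (p = 2%N -> forall c, c ^+ 2 != - b) ->
  is_minpoly iota g ('X^(p ^ s) - b%:P).
Proof.
move=> pp b0 gb npow nsq; have p0 := prime_gt0 pp.
elim: s g gb => [|s IH] g gb.
  apply: is_minpolyI; rewrite ?monicXnsubC // ?root_XnsubC ?gb //.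
  move=> r; rewrite size_XnsubC // ltnS => /size1_polyC ->.
  by rewrite map_polyC rootC fmorph_eq0 => /eqP ->.
set u := g ^+ p; set P := (p ^ s)%N.
have P0 : (0 < P)%N by rewrite expn_gt0 p0.
have ub : u ^+ P = iota b by rewrite -exprM -expnS.
have umin := IH u ub.
have ualg : algebraicOver iota u.
  by case: umin => m0 m1 _; exists ('X^P - b%:P) => //; exact: monic_neq0.
have [K' [iota' K'P]] := subfield_typeP (adjoin_subfield ualg).
have [u' u'E] : exists c, u = iota' c by apply/K'P; exact: adjoin_gen.
have u0 : u != 0.
  by apply: contraNneq b0 => u0; rewrite -(fmorph_eq0 iota) -ub u0 expr0n gtn_eqF.
have u'0 : u' != 0 by rewrite -(fmorph_eq0 iota') -u'E.
(* By the determinant argument, u is not a p-th power in K(u). *)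
have nroot c : c ^+ p != u'.
  apply: contraTneq isT => cu.
  have [r rE] : adjoin iota u (iota' c) by apply/K'P; exists c.
  have dv : 'X^P - b%:P %| r ^+ p - 'X.
    case: umin => _ _; apply; rewrite rootE rmorphB rmorphXn /= map_polyX.
    by rewrite hornerD hornerN horner_exp hornerX -rE -rmorphXn cu -u'E subrr.
  have szP : size ('X^P - b%:P) = P.-1.+2 by rewrite size_XnsubC // prednK.
  have [C CE] := companion_exists (monicXnsubC _ P0) szP.
  have : horner_mx C (r ^+ p - 'X) = 0 by apply: horner_mx_dvd; rewrite CE.
  rewrite rmorphB rmorphXn /= horner_mx_X => /eqP; rewrite subr_eq0 => /eqP Cr.
  have detX k (A : 'M[K]_P.-1.+1) : \det (A ^+ k) = \det A ^+ k.
    by elim: k => [|k IHk]; rewrite ?expr0 ?det1 // !exprS -mulmxE det_mulmx IHk.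
  have := char_poly_det C; rewrite CE -Cr detX coefB coefXn coefC eqxx /=.
  rewrite eq_sym (gtn_eqF P0) sub0r; move: (\det _) => D; rewrite prednK // => E.
  (* The equation reads -b = (-1)^P D^p. For odd P, b is a p-th power; an even P forces p = 2, and
     -b is a square. *)
  have [oP|eP] := boolP (odd P).
    move: E; rewrite -signr_odd oP expr1 mulN1r => /oppr_inj E.
    by have := npow D; rewrite -E eqxx.
  have p2 : p = 2%N.
    apply/eqP; apply: contraNT eP => p2; rewrite oddX.
    by case: (even_prime pp) p2 => [->|->]; rewrite ?orbT.
  move: E; rewrite -signr_odd (negPf eP) expr0 mul1r => E.
  by have := nsq p2 D; rewrite E p2 eqxx.
have galg : algebraicOver iota' g.
  exists ('X^p - u'%:P); first by rewrite monic_neq0 // monicXnsubC.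
  by rewrite root_XnsubC -u'E.
have [f fmin] := minpoly_exists galg; have [fm fg fd] := fmin.
have f1 := minpoly_size_gt1 fmin.
have fdiv : f %| 'X^p - u'%:P by apply: fd; rewrite root_XnsubC -u'E.
have szf : (p < size f)%N.
  rewrite ltnNge; apply/negP => fp.
  have [|c cu] := XpsubC_factor pp u'0 fm fdiv; first by rewrite f1.
  by have := nroot c; rewrite cu eqxx.
have Pp0 : (0 < p ^ s.+1)%N by rewrite expn_gt0 p0.
apply: is_minpolyI; rewrite ?monicXnsubC // ?root_XnsubC ?gb //.
move=> r; rewrite size_XnsubC // ltnS expnSr -/P => szr.
rewrite rootE (sum_poly_split iota g szr) -/u => /eqP sum0.
pose rj j := \poly_(i < P) r`_(i * p + j).
have /choice[dj djE] : forall j, exists d, iota' d = (map_poly iota (rj j)).[u].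
  move=> j; have [|d ->] := (K'P (map_poly iota (rj j)).[u]).1; last by exists d.
  by exists (rj j).
have R0 : \poly_(j < p) dj j = 0.
  apply: (minpoly_small fmin); first exact: leq_ltn_trans (size_poly _ _) szf.
  rewrite rootE (@horner_coef_wide _ p); last by rewrite (leq_trans (size_poly _ _)) // size_poly.
  apply/eqP; rewrite -[RHS]sum0; apply: eq_bigr => j _.
  by rewrite coef_map coef_poly ltn_ord /= djE.
have rj0 j : (j < p)%N -> rj j = 0.
  move=> jp; apply: (minpoly_small umin).
    by rewrite size_XnsubC // ltnS size_poly.
  rewrite rootE -djE -(rmorph0 iota'); apply/eqP; congr (iota' _).
  by have := congr1 (fun q : {poly K'} => q`_j) R0; rewrite coef_poly jp coef0.
apply/polyP => k; rewrite coef0.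
have [kP|kP] := ltnP k (P * p); last by rewrite nth_default // (leq_trans szr).
have := congr1 (fun q : {poly K} => q`_(k %/ p)%N) (rj0 (k %% p)%N (ltn_pmod _ p0)).
by rewrite coef_poly coef0 ltn_divLR // kP -divn_eq.
Qed.

Lemma char_poly_mx_dvd (R : comNzRingType) d (A : 'M[R]_d.+1) (phi : {poly R}) :
  exists Q, phi%:M - map_mx polyC (horner_mx A phi) = char_poly_mx A * Q.
Proof.
elim/poly_ind: phi => [|phi c [Q E]].
  by exists 0; rewrite rmorph0 !raddf0 addr0 mulr0.
exists (Q * 'X%:M + map_mx polyC (horner_mx A phi)).
set H := horner_mx A phi in E *.
have cA : map_mx polyC A * map_mx polyC H = map_mx polyC H * map_mx polyC A.
  rewrite -!rmorphM /=; congr (map_mx _ _); apply/esym; exact: comm_horner_mx.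
have cX (M : 'M[{poly R}]_d.+1) : 'X%:M * M = M * 'X%:M by rewrite -mulmxE scalar_mxC.
have -> : horner_mx A (phi * 'X + c%:P) = H * A + c%:M.
  by rewrite rmorphD rmorphM /= horner_mx_X horner_mx_C.
have -> : (phi * 'X + c%:P)%:M = phi%:M * 'X%:M + map_mx polyC c%:M :> 'M[{poly R}]_d.+1.
  by rewrite raddfD /= scalar_mxM map_scalar_mx.
have -> : map_mx polyC (H * A + c%:M) = map_mx polyC H * map_mx polyC A + map_mx polyC c%:M.
  by rewrite map_mxD -!mulmxE map_mxM.
rewrite mulrDr mulrA -E mulrBl /char_poly_mx mulrBl cX cA.
by rewrite opprD addrACA subrr addr0 addrA subrK.
Qed.

(** When phi(A) = 0, the scalar matrix phi is a multiple of the characteristic matrix X - A; take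
    determinants. *)
Lemma char_poly_dvd_exp (K : fieldType) d (A : 'M[K]_d.+1) (phi : {poly K}) :
  horner_mx A phi = 0 -> char_poly A %| phi ^+ d.+1.
Proof.
move=> h; have [Q] := char_poly_mx_dvd A phi.
rewrite h raddf0 subr0 => /(congr1 determinant).
by rewrite det_scalar -mulmxE det_mulmx => ->; exact: dvdp_mulIl.
Qed.

Lemma dvd_exp_monic (K : fieldType) (phi q : {poly K}) N :
  phi \is monic -> (forall p, phi %| p \/ coprimep p phi) ->
  q \is monic -> q %| phi ^+ N -> exists l, q = phi ^+ l.
Proof.
move=> phim dich; elim: N q => [|N IH] q qm.
  rewrite expr0 dvdp1 => /eqP sq; exists 0%N; rewrite expr0.
  apply/eqP; rewrite -eqp_monic ?monic1 //; rewrite -size_poly_eq1; exact/eqP.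
have [/dvdpP[q' qE]|cop] := dich q; last first.
  rewrite exprS Gauss_dvdpr //; exact: IH.
have q'm : q' \is monic by rewrite -(monicMr _ phim) -qE.
rewrite qE mulrC exprS dvdp_mul2l ?monic_neq0 // => /(IH q' q'm)[l ->].
by exists l.+1; rewrite exprS mulrC.
Qed.

Lemma char_poly_minpoly (K F : fieldType) (iota : {rmorphism K -> F}) (g : F) phi
    d (A : 'M[K]_d.+1) :
  is_minpoly iota g phi -> horner_mx A phi = 0 -> exists l, char_poly A = phi ^+ l.
Proof.
move=> phimin A0; have [phim _ phid] := phimin.
apply: dvd_exp_monic phim _ (char_poly_monic _) (char_poly_dvd_exp A0) => p.
have [pg|pg] := boolP (root (map_poly iota p) g); first by left; exact: phid.
by right; exact: minpoly_coprime phimin pg.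
Qed.

(** Let C be the companion matrix of the minimal polynomial f of g, so that C^n = b. For P the
    p-part of n, the matrix C^(n/P) is annihilated by X^P - b, the minimal polynomial of g^(n/P).
    Its characteristic polynomial is a power of that one, so P divides deg f. Hence n divides deg f,
    and f is X^n - b. *)
Lemma XnsubC_minpoly (K F : fieldType) (iota : {rmorphism K -> F}) (n : nat) b (g : F) :
  (0 < n)%N -> b != 0 -> g ^+ n = iota b ->
  (forall p, prime p -> (p %| n)%N -> forall c, c ^+ p != b) ->
  ((2 %| n)%N -> forall c, c ^+ 2 != - b) ->
  is_minpoly iota g ('X^n - b%:P).
Proof.
move=> n0 b0 gb npow nsq.
have gr : root (map_poly iota ('X^n - b%:P)) g by rewrite root_XnsubC gb.
have galg : algebraicOver iota g.
  by exists ('X^n - b%:P) => //; rewrite monic_neq0 // monicXnsubC.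
have [f fmin] := minpoly_exists galg; have [fm fg fd] := fmin.
have f1 := minpoly_size_gt1 fmin; have fn := fd _ gr.
have [e szf] : exists e, size f = e.+2 by case: (size f) f1 => [|[|e]] // _; exists e.
have [C CE] := companion_exists fm szf.
have Cn : C ^+ n = b%:M.
  apply/eqP; rewrite -subr_eq0 -horner_mx_XnsubC; apply/eqP.
  by apply: horner_mx_dvd; rewrite CE.
have ne : (n %| e.+1)%N.
  apply/dvdn_partP => // p; rewrite mem_primes => /and3P[pp _ pn].
  rewrite p_part; set P := (p ^ _)%N.
  have nE : n = (n %/ P * P)%N by rewrite divnK // pfactor_dvdnn.
  have hmin : is_minpoly iota (g ^+ (n %/ P)) ('X^P - b%:P).
    apply: prime_power_minpoly => //; first by rewrite -exprM -/P -nE.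
      exact: npow.
    by move=> p2; apply: nsq; rewrite -p2.
  have [|l] := char_poly_minpoly (A := C ^+ (n %/ P)) hmin.
    by rewrite horner_mx_XnsubC -exprM -nE Cn subrr.
  move=> /(congr1 (fun q : {poly K} => (size q).-1)).
  rewrite size_char_poly size_exp /= size_XnsubC ?expn_gt0 ?prime_gt0 //= => ->.
  exact: dvdn_mulr.
suff -> : 'X^n - b%:P = f by [].
apply/eqP; rewrite -eqp_monic ?monicXnsubC // eqp_sym -dvdp_size_eqp //.
rewrite eqn_leq dvdp_leq // ?monic_neq0 ?monicXnsubC //=.
by rewrite szf size_XnsubC // ltnS dvdn_leq.
Qed.

(** The characteristic polynomial of A is a power of X^n - b, hence a polynomial in X^n. With n > 1
    dividing the dimension, the coefficient that gives the trace sits at an exponent not divisible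
    by n. *)
Lemma mxtrace_XnsubC (K F : fieldType) (iota : {rmorphism K -> F}) (n : nat) b (g : F)
    d (A : 'M[K]_d.+1) : (1 < n)%N ->
  is_minpoly iota g ('X^n - b%:P) -> A ^+ n = b%:M -> \tr A = 0.
Proof.
move=> n1 gmin An; have n0 := ltnW n1.
have [|l lE] := char_poly_minpoly (A := A) gmin.
  by rewrite horner_mx_XnsubC An subrr.
have dE : d.+1 = (n * l)%N.
  have := congr1 (fun q : {poly K} => (size q).-1) lE.
  by rewrite size_char_poly size_exp size_XnsubC.
have := char_poly_trace A (ltn0Sn d); rewrite lE /=.
have -> : ('X^n - b%:P) ^+ l = ('X - b%:P) ^+ l \Po 'X^n.
  by rewrite rmorphXn /= comp_polyB comp_polyX comp_polyC.
rewrite coef_comp_poly_Xn //.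
case: ifP => [nd|_ /eqP]; last by rewrite eq_sym oppr_eq0 => /eqP.
have /negP[] : ~~ (n %| d.+1)%N by rewrite -addn1 dvdn_addr // dvdn1 gtn_eqF.
by rewrite dE dvdn_mulr.
Qed.

(** * Linear independence of radicals *)

Section Independence.
Variables (K F : fieldType) (iota : {rmorphism K -> F}) (G : zmodType) (chi : G -> F).
Hypothesis F0 : [pchar F] =i pred0.
Hypothesis chiD : forall x y, chi (x + y) = chi x * chi y.
Hypothesis chi_neq0 : forall x, chi x != 0.
Hypothesis tors : forall x, exists n a, (0 < n)%N /\ chi x ^+ n = iota a.
Hypothesis T1 : forall p a x, prime p -> (iota a * chi x) ^+ p = 1 ->
  exists c, chi x = iota c.
Hypothesis T2 : forall z : F, z ^+ 2 = -1 -> exists c, z = iota c.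

Lemma character0 : chi 0 = 1.
Proof.
apply: (mulfI (chi_neq0 0)); by rewrite -chiD addr0 mulr1.
Qed.

Lemma characterMn x n : chi (x *+ n) = chi x ^+ n.
Proof.
by elim: n => [|n IH]; rewrite ?mulr0n ?expr0 ?character0 // mulrS chiD IH exprS.
Qed.

(** Take the least n > 0 with chi(x)^n in K. If b = c^p with p dividing n, then chi(x)^(n/p) / c is
    a p-th root of unity and [T1] puts chi(x)^(n/p) in K; if -b = c^2 with n even, chi(x)^(n/2) / c
    is a square root of -1 and [T2] applies. Both contradict minimality. *)
Lemma character_minpoly x : ~ (exists c, chi x = iota c) ->
  exists n b, [/\ (1 < n)%N, chi x ^+ n = iota b &
    is_minpoly iota (chi x) ('X^n - b%:P)].
Proof.
move=> nx.
have ex : exists n, (0 < n)%N && `[< exists a, chi x ^+ n = iota a >].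
  have [n [a [n0 na]]] := tors x; exists n; rewrite n0; apply/asboolP; by exists a.
have [n /andP[n0 /asboolP[b nb]] nmin] := ex_minnP ex.
have n1 : (1 < n)%N.
  by rewrite ltn_neqAle n0 andbT eq_sym; apply/eqP => n1; apply: nx; exists b; rewrite -nb n1 expr1.
exists n, b; split=> //.
have b0 : b != 0 by rewrite -(fmorph_eq0 iota) -nb expf_neq0.
have small m : (0 < m < n)%N -> ~ exists a, chi x ^+ m = iota a.
  by move=> /andP[m0 mn] h; have := nmin m; rewrite m0 leqNgt mn => /(_ (introT (asboolP _) h)).
have div p : prime p -> (p %| n)%N -> (0 < n %/ p < n)%N /\ chi x ^+ n = (chi x ^+ (n %/ p)) ^+ p.
  move=> pp pn; rewrite -exprM divnK //; split=> //.
  by rewrite divn_gt0 ?prime_gt0 // dvdn_leq //= ltn_Pdiv ?prime_gt1.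
apply: XnsubC_minpoly => // [p pp pn c|pn c]; apply/eqP => cb.
  have [/small nex nE] := div p pp pn; apply: nex.
  have c0 : iota c != 0.
    rewrite fmorph_eq0; apply: contraNneq b0 => c0.
    by rewrite -cb c0 expr0n gtn_eqF // prime_gt0.
  rewrite -characterMn; apply: (T1 (p := p) (a := c^-1)) => //.
  by rewrite fmorphV exprMn characterMn -nE nb -cb rmorphXn exprVn mulVf // expf_neq0.
have [/small nex nE] := div 2 isT pn; apply: nex.
have c0 : iota c != 0.
  rewrite fmorph_eq0; apply: contraNneq b0 => c0.
  by rewrite -oppr_eq0 -cb c0 expr0n.
have [|d dE] := T2 (z := chi x ^+ (n %/ 2) / iota c).
  rewrite expr_div_n -nE nb -rmorphXn cb rmorphN invrN mulrN divff //.
  by rewrite fmorph_eq0.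
by exists (d * c); rewrite rmorphM -dE mulfVK.
Qed.

(* The trace of an extension containing all [chi (x - x0)] isolates c x0. *)
Lemma character_independent (s : seq G) (c : G -> K) : uniq s ->
  (forall x y, x \in s -> y \in s -> x != y -> ~ exists a, chi (x - y) = iota a) ->
  \sum_(x <- s) iota (c x) * chi x = 0 -> forall x, x \in s -> c x = 0.
Proof.
move=> us sdiff sum0 x0 x0s.
have K0 := pchar0_rmorph iota F0.
have [|t talg ts] := @primitive_element_seq K F iota [seq chi (x - x0) | x <- s] K0.
  move=> _ /mapP[x _ ->]; have [n [a [n0 na]]] := tors (x - x0).
  exists ('X^n - a%:P); first by rewrite monic_neq0 // monicXnsubC.
  by rewrite root_XnsubC na.
have [mu mumin] := minpoly_exists talg.
have [e [psi [szmu psiB psiM psiC]]] := adjoin_rep mumin.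
have sum1 : \sum_(x <- s) iota (c x) * chi (x - x0) = 0.
  transitivity ((\sum_(x <- s) iota (c x) * chi x) * chi (- x0)); last by rewrite sum0 mul0r.
  by rewrite mulr_suml; apply: eq_bigr => x _; rewrite chiD mulrA.
have psis : psi (\sum_(x <- s) iota (c x) * chi (x - x0)) =
   \sum_(x <- s) c x *: psi (chi (x - x0)).
  have : {subset s <= s} by [].
  have /= : forall l : seq G, {subset l <= s} ->
    adjoin iota t (\sum_(x <- l) iota (c x) * chi (x - x0)) /\
    psi (\sum_(x <- l) iota (c x) * chi (x - x0)) = \sum_(x <- l) c x *: psi (chi (x - x0)).
    elim=> [|x l IH] ls; first by rewrite !big_nil (adjoin_rep0 psiC); split=> //; exact: adjoin0.
    have [|IH1 IH2] := IH; first by move=> y yl; apply: ls; rewrite inE yl orbT.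
    have xt : adjoin iota t (chi (x - x0)) by apply/ts/map_f/ls/mem_head.
    have ct := adjoin_const iota t (c x).
    rewrite !big_cons (adjoin_repD psiB psiC) ?psiM ?psiC ?IH2 //; last exact: adjoinM.
    rewrite -mulmxE mul_scalar_mx; split=> //; apply: adjoinD => //; exact: adjoinM.
  by move=> H /H[].
move: psis; rewrite sum1 (adjoin_rep0 psiC) => /(congr1 mxtrace); rewrite mxtrace0 raddf_sum /=.
(* The term of x0 has trace c(x0) times the dimension, which is nonzero in characteristic zero; all
   other terms have trace zero. *)
rewrite (bigD1_seq x0) //= subrr character0 (adjoin_rep1 psiC) big1_seq ?addr0.
  rewrite mxtraceZ mxtrace1 => /eqP; rewrite eq_sym mulf_eq0 => /orP[/eqP //|].
  by have /pcharf0P -> := K0.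
move=> x /andP[xx0 xs]; rewrite mxtraceZ.
have [n [b [n1 nb nmin]]] := character_minpoly (sdiff x x0 xs x0s xx0).
rewrite (mxtrace_XnsubC n1 nmin) ?mulr0 // -(adjoin_repX psiM psiC); last exact/ts/map_f.
by rewrite nb psiC.
Qed.
End Independence.

(** * Choosing the field E *)

Section Span.
Variable G : zmodType.
Implicit Types (s : seq G) (H : set G).

Lemma subgroupD H x y : subgroup H -> H x -> H y -> H (x + y).
Proof.
move=> [H0 Hsub] Hx Hy; rewrite -[y]opprK; apply: (Hsub) => //.
by rewrite -sub0r; apply: (Hsub).
Qed.

Lemma subgroupN H x : subgroup H -> H x -> H (- x).
Proof. by move=> [H0 Hsub] Hx; rewrite -sub0r; apply: Hsub. Qed.

Lemma subgroupMz H x n : subgroup H -> H x -> H (x *~ n).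
Proof.
move=> HH Hx; have Hn m : H (x *+ m).
  elim: m => [|m IH]; first by case: HH.
  by rewrite mulrS; apply: subgroupD.
by case: n => n; [exact: Hn | rewrite NegzE mulrNz; apply: subgroupN => //; exact: Hn].
Qed.

Lemma subgroup_sum H (I : Type) (r : seq I) (P : pred I) (f : I -> G) : subgroup H ->
  (forall i, P i -> H (f i)) -> H (\sum_(i <- r | P i) f i).
Proof.
move=> HH Hf; elim/big_ind: _ => //; first by case: HH.
by move=> x y; apply: subgroupD.
Qed.

Lemma span_subgroup s : subgroup (Defs.span s).
Proof.
split=> [|_ _ [z ->] [w ->]].
  by exists (fun=> 0); rewrite big1 // => i _; rewrite mulr0z.
exists (fun i => z i - w i); rewrite -sumrB; apply: eq_bigr => i _.
by rewrite mulrzBr.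
Qed.

Lemma span_mem s x : x \in s -> Defs.span s x.
Proof.
move=> xs; have xi : (index x s < size s)%N by rewrite index_mem.
exists (fun i => (i == Ordinal xi)%:Z); rewrite (bigD1 (Ordinal xi)) //= eqxx mulr1z.
by rewrite nth_index // big1 ?addr0 // => i /negPf ->; rewrite mulr0z.
Qed.

Lemma span_sub s H : subgroup H -> (forall x, x \in s -> H x) ->
  (Defs.span s `<=` H)%classic.
Proof.
move=> HH sH _ [z ->]; apply: subgroup_sum => // i _; apply: subgroupMz => //.
by apply/sH/mem_nth.
Qed.

End Span.

Lemma prime_primitive_root (F : fieldType) p (w : F) : prime p -> w ^+ p = 1 -> w != 1 ->
  p.-primitive_root w.
Proof.
move=> pp wp w1; have [m mw] := prim_order_exists (prime_gt0 pp) wp.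
case/primeP: pp => _ /[apply] /orP[/eqP m1|/eqP <- //].
by move: mw w1; rewrite m1 => /prim_expr_order; rewrite expr1 => ->; rewrite eqxx.
Qed.

Lemma field_gen_mem (F : fieldType) (s : seq F) x : x \in s -> field_gen s x.
Proof. by move=> xs S _; apply. Qed.

Lemma field_gen_sub (F : fieldType) (s s' : seq F) : {subset s <= s'} ->
  forall x, field_gen s x -> field_gen s' x.
Proof. by move=> ss x xs S SS sS; apply: xs => // y /ss /sS. Qed.

Lemma subfieldX (F : fieldType) (S : set F) x n : subfield S -> S x -> S (x ^+ n).
Proof.
move=> [S1 SB SM SV] Sx; elim: n => [|n IH]; first by rewrite expr0.
by rewrite exprS; apply: SM.
Qed.

(** * Norms for extensions by roots of unity *)

Section NormMap.
Variable F : fieldType.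
Variable B : nat.

(** What is kept of a norm from [E'] to [E], with [d] in the role of the degree. These properties
    compose along towers. *)
Definition norm_map (E E' : set F) (nu : F -> F) d : Prop :=
  [/\ forall x y, E' x -> E' y -> nu (x * y) = nu x * nu y,
      forall x, E' x -> E (nu x),
      forall c, E c -> nu c = c ^+ d &
      forall p, prime p -> (p %| d)%N -> (p <= B)%N].

(** The root z is a zero of X - 1 or of 1 + X + ... + X^(p-1), so its degree is below p and has
    prime factors below p only. The norm is the determinant of multiplication. *)
Lemma norm_map_adjoin (s : seq F) z p : prime p -> (p <= B)%N -> z ^+ p = 1 ->
  exists nu d, norm_map (field_gen s) (field_gen (rcons s z)) nu d.
Proof.
move=> pp pB zp; have p0 := prime_gt0 pp; have p1 := prime_gt1 pp.
have [K [iota KP]] := subfield_typeP (field_gen_subfield s).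
have [q [q0 szq qz]] : exists q : {poly K}, [/\ q != 0, (size q <= p)%N & root (map_poly iota q) z].
  have [z1|z1] := eqVneq z 1.
    exists ('X - 1%:P); rewrite polyXsubC_eq0 size_XsubC; split=> //.
    by rewrite rmorphB /= map_polyX map_polyC /= z1 rmorph1 root_XsubC.
  have szs : size (\sum_(i < p) 'X^i : {poly K}) = p.
    have -> : \sum_(i < p) 'X^i = \poly_(i < p) 1 :> {poly K}.
      by rewrite poly_def; apply: eq_bigr => i _; rewrite scale1r.
    by rewrite size_poly_eq ?oner_neq0.
  exists (\sum_(i < p) 'X^i); rewrite szs; split=> //.
    by rewrite -size_poly_gt0 szs.
  rewrite rmorph_sum rootE horner_sum; under eq_bigr do rewrite /= map_polyXn hornerXn.
  apply/eqP; apply: (mulfI (x := z - 1)); first by rewrite subr_eq0.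
  by rewrite mulr0 -subrX1 zp subrr.
have zalg : algebraicOver iota z by exists q.
have [mu mumin] := minpoly_exists zalg.
have [e [psi [szmu psiB psiM psiC]]] := adjoin_rep mumin.
have ep : (e.+1 < p)%N.
  case: mumin => _ _ mud; rewrite -szmu; apply: leq_trans szq.
  exact: dvdp_leq q0 (mud _ qz).
have sub x : field_gen (rcons s z) x -> adjoin iota z x.
  apply; first exact: adjoin_subfield.
  move=> y; rewrite mem_rcons inE => /orP[/eqP ->|ys]; first exact: adjoin_gen.
  by have [|c ->] := (KP y).1; [exact: field_gen_mem | exact: adjoin_const].
exists (fun x => iota (\det (psi x))), e.+1; split.
- by move=> x y /sub xz /sub yz; rewrite psiM // -mulmxE det_mulmx rmorphM.
- by move=> x _; apply/KP; exists (\det (psi x)).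
- by move=> c /KP[c' ->]; rewrite psiC det_scalar rmorphXn.
- move=> p' _ /(dvdn_leq (ltn0Sn e)) le; apply: leq_trans le _.
  exact: leq_trans (ltnW ep) pB.
Qed.

Lemma norm_map_roots (zs s : seq F) :
  (forall z, z \in zs -> exists p, [/\ prime p, (p <= B)%N & z ^+ p = 1]) ->
  exists nu d, norm_map (field_gen s) (field_gen (s ++ zs)) nu d.
Proof.
elim: zs s => [|z zs IH] s H.
  exists id, 1%N; rewrite cats0; split=> //.
  by move=> p pp; rewrite dvdn1 => /eqP p1; rewrite p1 in pp.
have [p [pp pB zp]] := H z (mem_head _ _).
have [|nu' [d' [M' I' C' P']]] := IH (rcons s z).
  by move=> y yz; apply: H; rewrite inE yz orbT.
have [nu [d [M I C P]]] := norm_map_adjoin s pp pB zp.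
rewrite cat_rcons in M' I'.
exists (nu \o nu'), (d' * d)%N; split => /=.
- by move=> x y Ex Ey; rewrite M' // M //; apply: I'.
- by move=> x Ex; exact: I (I' _ Ex).
- move=> c Ec; rewrite C' ?C ?exprM //.
    exact: (@subfieldX _ (field_gen s) c d' (field_gen_subfield s) Ec).
  by apply: field_gen_sub Ec => y ys; rewrite mem_rcons inE ys orbT.
- by move=> q qp; rewrite Euclid_dvdM // => /orP[/(P' q qp)|/(P q qp)].
Qed.
End NormMap.

(** * Radicals modulo the span of [hs] *)

Section Character.
Variables (F : fieldType) (G : zmodType) (chi : G -> F).
Hypothesis F0 : [pchar F] =i pred0.
Hypothesis chiD : forall x y, chi (x + y) = chi x * chi y.
Hypothesis chi_neq0 : forall x, chi x != 0.
Hypothesis chi_inj : injective chi.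
Variable hs : seq G.
Hypothesis hs_tors : forall g, exists2 n, (0 < n)%N & Defs.span hs (g *+ n).

Let chi0 : chi 0 = 1 := character0 chiD chi_neq0.
Let chiX x n : chi (x *+ n) = chi x ^+ n := characterMn chiD chi_neq0 x n.

Lemma characterN x : chi (- x) = (chi x)^-1.
Proof. by apply: (mulfI (chi_neq0 x)); rewrite -chiD subrr mulfV. Qed.

Lemma characterB x y : chi (x - y) = chi x / chi y.
Proof. by rewrite chiD characterN. Qed.

Lemma preim_subgroup (E : set F) : subfield E -> subgroup [set g | E (chi g)].
Proof.
move=> [E1 EB EM EV]; split=> [|x y Ex Ey] /=; first by rewrite chi0.
by rewrite characterB; apply: EM => //; apply: EV.
Qed.

Lemma character_span (E : set F) : subfield E -> (forall h, h \in hs -> E (chi h)) ->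
  forall g, Defs.span hs g -> E (chi g).
Proof.
move=> Esub Ehs; apply: span_sub (preim_subgroup Esub) Ehs.
Qed.

Section Isolator.
Variable s : seq F.
Let E := field_gen s.
Hypothesis hsE : forall h, h \in hs -> E (chi h).

(* Modulo the span, the exponents of a radical can be reduced to be at most n. *)
Lemma isolator_cover : exists ys : seq F, forall a n g, E a -> (0 < n)%N ->
  Defs.span hs g -> a ^+ n = chi g ->
  exists y h, [/\ y \in ys, Defs.span hs h & a = y * chi h].
Proof.
have [|ys Hys] := isolator_finite (s := s) (hs := map chi hs) F0.
  by move=> _ /mapP[h /hsE Eh ->].
exists ys => a n g Ea n0 [z gE] an; have nz : n%:Z != 0 by rewrite eqz_nat -lt0n.
pose q : G := \sum_(i < size hs) hs`_i *~ (z i %/ n)%Z.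
have hq : Defs.span hs q by exists (fun i => (z i %/ n)%Z).
have Esub : subfield E := field_gen_subfield s.
have Eq := character_span Esub hsE hq.
have [_ _ EM EV] := Esub.
exists (a / chi q), q; split=> //; last by rewrite mulfVK.
apply: Hys; split; first by apply: EM => //; apply: EV.
(* [isolator_finite] indexes the exponents by the size of [map chi hs]; extending [z] by 0 to all
   naturals avoids a cast between ordinals. *)
pose zz (i : nat) : int := if insub i is Some j then z j else 0.
exists n, (fun i => `|(zz i %% n)%Z|%N); split=> // [i|].
  apply: ltnW; rewrite -ltz_nat gez0_abs; first by rewrite ltz_pmod.
  exact: modz_ge0.
rewrite expr_div_n an -chiX -characterB.
have -> : g - q *+ n = \sum_(i < size hs) hs`_i *+ `|(zz i %% n)%Z|%N.
  rewrite gE /q -sumrMnl -sumrB; apply: eq_bigr => i _.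
  have -> : hs`_i *~ z i = hs`_i *~ (z i %/ n)%Z *+ n + hs`_i *~ (z i %% n)%Z.
    by rewrite {1}(divz_eq (z i) n) mulrzDr mulrzA -pmulrn.
  by rewrite addrAC subrr add0r /zz valK pmulrn gez0_abs // modz_ge0.
rewrite size_map (big_morph chi chiD chi0); apply: eq_bigr => i _.
by rewrite chiX (nth_map 0).
Qed.

(** Generators are [hs] and one preimage under [chi] for each value of the finite list [ys] that is
    attained: if chi(g) = y chi(h), then g - h is the preimage of y, unique by injectivity. *)
Lemma preim_fin_gen : fin_gen_subgroup [set g | E (chi g)].
Proof.
have [ys Hys] := isolator_cover.
have Esub : subfield E := field_gen_subfield s.
have Hsub := preim_subgroup Esub.
have [gs [gsE gsP]] : exists gs : seq G, (forall g, g \in gs -> E (chi g)) /\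
    forall g, E (chi g) -> chi g \in ys -> g \in gs.
  elim: (ys) => [|y l [gs [gsE gsP]]]; first by exists [::].
  have [[g0 [Eg0 g0y]]|nex] := pselect (exists g, E (chi g) /\ chi g = y).
    exists (g0 :: gs); split=> g; first by rewrite inE => /orP[/eqP ->|/gsE].
    move=> Eg; rewrite !inE => /orP[/eqP gy|gl]; last by rewrite gsP ?orbT.
    by rewrite -g0y in gy; rewrite (chi_inj gy) eqxx.
  exists gs; split=> // g Eg; rewrite inE => /orP[/eqP gy|]; last exact: gsP.
  by case: nex; exists g.
exists (hs ++ gs); apply/seteqP; split; last first.
  apply: span_sub => // x; rewrite mem_cat => /orP[/hsE //|/gsE //].
move=> g Eg; have [n n0 gn] := hs_tors g.
have [y [h [yys hh gyh]]] := Hys (chi g) n (g *+ n) Eg n0 gn (esym (chiX g n)).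
have Eh := character_span Esub hsE hh.
have yE : chi (g - h) = y by rewrite characterB gyh mulfK.
have Ss := span_subgroup (hs ++ gs).
rewrite -(subrK h g); apply: subgroupD => //.
  apply: span_mem; rewrite mem_cat gsP ?orbT // ?yE //.
  by rewrite -yE; apply: (proj2 Hsub).
by apply: (span_sub (s := hs)) hh => // x xs; apply: span_mem; rewrite mem_cat xs.
Qed.

(** The coefficient [a] is a radical, so it may be replaced by some y of a finite list, and it
    suffices to bound p for fixed y. Any single pair (p0, g0) for y provides the bound max(p0,
    B0). *)
Lemma prime_root_bound (B0 : nat) :
  (forall p x, prime p -> x *+ p = 0 -> x != 0 :> G -> (p <= B0)%N) ->
  exists B, forall p a g, prime p -> E a -> (a * chi g) ^+ p = 1 ->
    a * chi g != 1 -> (p <= B)%N.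
Proof.
move=> HB0; have [ys Hys] := isolator_cover.
have [B HB] : exists B, forall y, y \in ys -> forall p g, prime p ->
    (y * chi g) ^+ p = 1 -> y * chi g != 1 -> (p <= B)%N.
  elim: (ys) => [|y l [B HB]]; first by exists 0%N.
  have [By Hy] : exists B, forall p g, prime p ->
    (y * chi g) ^+ p = 1 -> y * chi g != 1 -> (p <= B)%N.
    have [[p0 [g0 [pp0 g01 g0n]]]|nex] := pselect (exists p g, [/\ prime p,
      (y * chi g) ^+ p = 1 & y * chi g != 1]); last first.
      by exists 0%N => p g pp g1 gn; case: nex; exists p, g.
    exists (maxn p0 B0) => p g pp g1 gn; rewrite leq_max.
    have [//|lt0 /=] := leqP p p0; rewrite leqNgt; apply/negP => ltB.
    (* Otherwise this element has order p, which exceeds [B0]. Then y chi(g) has order dividing p0,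
       against p > p0. *)
    have gg : (g - g0) *+ p0 = 0.
      apply: contraTeq ltB => x0; rewrite -leqNgt; apply: (HB0 p) x0 => //.
      apply: chi_inj; rewrite -mulrnA chi0 chiX characterB.
      have -> : chi g / chi g0 = (y * chi g) / (y * chi g0).
        have y0 : y != 0.
          apply/eqP => y0; move/eqP: (g01); rewrite y0 mul0r expr0n.
          by rewrite gtn_eqF ?prime_gt0 // eq_sym oner_eq0.
        by rewrite invfM mulrACA mulfV // mul1r.
      by rewrite expr_div_n mulnC exprM g1 expr1n mulnC exprM g01 expr1n divr1.
    have gp0 : (y * chi g) ^+ p0 = 1.
      rewrite -(subrK g0 g) chiD mulrCA exprMn -chiX gg chi0 mul1r.
      exact: g01.
    have := prime_primitive_root pp g1 gn => /prim_order_dvd/(_ p0).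
    rewrite gp0 eqxx => /dvdn_leq; rewrite prime_gt0 // => /(_ isT).
    by rewrite leqNgt lt0.
  exists (maxn By B) => y'; rewrite inE => /orP[/eqP ->|y'l] p g pp g1 gn; rewrite leq_max.
    by rewrite (Hy p g).
  by rewrite (HB y' y'l p g) ?orbT.
exists B => p a g pp Ea ag1 agn.
have [n n0 gn] := hs_tors (- (g *+ p)).
have [||y [h [yys hh ayh]]] := Hys a (p * n)%N (- (g *+ p) *+ n) Ea _ gn.
- by rewrite muln_gt0 prime_gt0.
- rewrite chiX characterN chiX exprM; congr (_ ^+ _).
  by apply: (mulIf (x := chi g ^+ p)); rewrite ?expf_neq0 // mulVf ?expf_neq0 // -exprMn.
apply: (HB y yys p (h + g)) => //; by rewrite chiD mulrA -ayh.
Qed.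
End Isolator.
End Character.

Lemma roots_of_unity_seq (F : fieldType) B : exists zs : seq F,
  (forall z p, prime p -> (p <= B)%N -> z ^+ p = 1 -> z \in zs) /\
  (forall z, z \in zs -> exists p, [/\ prime p, (p <= B)%N & z ^+ p = 1]).
Proof.
pose P (z : F) := exists p, [/\ prime p, (p <= B)%N & z ^+ p = 1].
have [l Hl] : finitely_many P.
  have [l Hl] : finitely_many (fun z : F => exists2 p, p \in iota 1 B & z ^+ p = 1).
    apply: finitely_many_bigcup => p; rewrite mem_iota => /andP[p1 _].
    have [l Hl] := roots_finite (monic_neq0 (monicXnsubC (1 : F) p1)).
    by exists l => z zp; apply: Hl; rewrite rootE hornerD hornerN hornerXn hornerC zp subrr.
  exists l => z [p [pp pB zp]]; apply: Hl; exists p => //.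
  by rewrite mem_iota prime_gt0 // add1n ltnS.
exists [seq z <- l | `[< P z >]]; split=> z; rewrite mem_filter.
  move=> p pp pB zp; have Pz : P z by exists p.
  by rewrite Hl // andbT; apply/asboolP.
by move=> /andP[/asboolP].
Qed.

Section GoodSubfield.
Variables (F : fieldType) (G : zmodType) (chi : G -> F).
Hypothesis F0 : [pchar F] =i pred0.
Hypothesis chiD : forall x y, chi (x + y) = chi x * chi y.
Hypothesis chi_neq0 : forall x, chi x != 0.
Hypothesis chi_inj : injective chi.
Variable hs : seq G.
Hypothesis hs_tors : forall g, exists2 n, (0 < n)%N & Defs.span hs (g *+ n).
Variable B0 : nat.
Hypothesis HB0 : forall p x, prime p -> x *+ p = 0 -> x != 0 :> G -> (p <= B0)%N.

Lemma radical_exponent (E : set F) a g p : subfield E ->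
  (forall h, h \in hs -> E (chi h)) -> (0 < p)%N -> (a * chi g) ^+ p = 1 ->
  exists2 n, (0 < n)%N & E (a ^+ n).
Proof.
move=> Esub hsE p0 ag; have [n n0 gn] := hs_tors (- (g *+ p)).
exists (p * n)%N; first by rewrite muln_gt0 p0.
have -> : a ^+ (p * n) = chi (- (g *+ p) *+ n).
  rewrite (characterMn chiD chi_neq0) (characterN chiD chi_neq0) (characterMn chiD chi_neq0) exprM.
  congr (_ ^+ _); apply: (mulIf (x := chi g ^+ p)); rewrite ?expf_neq0 //.
  by rewrite mulVf ?expf_neq0 // -exprMn.
exact: (character_span chiD chi_neq0 Esub hsE gn).
Qed.

Lemma norm_mapX (B : nat) (E E' : set F) nu d x n : norm_map B E E' nu d ->
  subfield E -> subfield E' -> (forall y, E y -> E' y) ->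
  E' x -> nu (x ^+ n) = nu x ^+ n.
Proof.
move=> [M _ C _] [E1 _ _ _] E's EE' Ex; elim: n => [|n IH].
  by rewrite !expr0 C // expr1n.
by rewrite !exprS M ?IH //; apply: subfieldX.
Qed.

(* The norm of a radical a is a ^+ d up to a root of unity xi. If p divides the
   order of xi then E' contains all p-th roots of unity; otherwise a power of
   a * chi g prime to p already lies in E * chi G. *)
Lemma norm_map_prime_root (B : nat) (E E' : set F) nu d p a g :
  norm_map B E E' nu d -> subfield E -> subfield E' -> (forall y, E y -> E' y) ->
  (forall h, h \in hs -> E (chi h)) ->
  (forall p a g, prime p -> E a -> (a * chi g) ^+ p = 1 ->
      a * chi g != 1 -> (p <= B)%N) ->
  prime p -> E' a -> (a * chi g) ^+ p = 1 -> (B < p)%N ->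
  E' (a * chi g).
Proof.
move=> nm Esub E'sub EE' hsE HB pp Ea ag Bp.
have [nM nE nC nP] := nm; have p0 := prime_gt0 pp.
have [E1 EB EM EV] := Esub; have [E'1 E'B E'M E'V] := E'sub.
have a0 : a != 0.
  apply/eqP => a0; move/eqP: (ag); rewrite a0 mul0r expr0n.
  by rewrite gtn_eqF // eq_sym oner_eq0.
have [N N0 aN] : exists2 n, (0 < n)%N & E (a ^+ n) := radical_exponent Esub hsE p0 ag.
pose xi := nu a / a ^+ d.
have nua : E' (nu a) := EE' _ (nE _ Ea).
have xiE : E' xi by apply: (E'M) => //; apply: (E'V); apply: subfieldX.
have xiN : xi ^+ N = 1.
  rewrite /xi expr_div_n -(norm_mapX N nm Esub E'sub EE' Ea) nC //.
  by rewrite -!exprM mulnC mulfV // expf_neq0.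
have [m cop NE] := pfactor_coprime pp N0; set v := logn p N in NE.
have omv : (xi ^+ m) ^+ (p ^ v) = 1 by rewrite -exprM -NE.
have [om1|om1] := eqVneq (xi ^+ m) 1; last first.
  have [eta [etaE etap eta1]] : exists eta, [/\ E' eta, eta ^+ p = 1 & eta != 1].
    elim: (v) (xi ^+ m) (subfieldX m E'sub xiE) omv om1 => [|w IH] om omE.
      by rewrite expr1 => ->; rewrite eqxx.
    rewrite expnS exprM => omw om1; have [omp|omp] := eqVneq (om ^+ p) 1.
      by exists om.
    by apply: IH omw omp; apply: subfieldX.
  have prim := prime_primitive_root pp etap eta1.
  by have [i ->] := prim_rootP prim ag; apply: subfieldX.
have nuam : nu a ^+ m = a ^+ (d * m).
  move: om1; rewrite expr_div_n -exprM => om.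
  by rewrite -[LHS](divfK (expf_neq0 (d * m) a0)) om mul1r.
have copdm : coprime p (d * m).
  rewrite coprimeMr cop andbT prime_coprime //; apply/negP => /(nP p pp).
  by rewrite leqNgt Bp.
have dmE : (a * chi g) ^+ (d * m) = nu a ^+ m * chi (g *+ (d * m)).
  by rewrite exprMn -nuam (characterMn chiD chi_neq0).
(* This power lies in E chi(G), where nontrivial p-th roots of unity require p <= B. *)
have dm1 : (a * chi g) ^+ (d * m) = 1.
  apply/eqP; apply: contraTT Bp => dmn; rewrite -leqNgt.
  apply: (HB p (nu a ^+ m) (g *+ (d * m))) => //; rewrite -?dmE //.
    exact: subfieldX (nE _ Ea).
  by rewrite -exprM mulnC exprM ag expr1n.
suff -> : a * chi g = 1 by [].
have [//|x1] := eqVneq (a * chi g) 1.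
have := prim_order_dvd (prime_primitive_root pp ag x1) (d * m).
rewrite dm1 eqxx => pdm; move: copdm.
by rewrite prime_coprime // pdm.
Qed.

Lemma exists_good_subfield (s0 : seq F) : exists E : set F,
  [/\ subfield E, forall y, y \in s0 -> E y,
      fin_gen_subgroup [set g | E (chi g)] &
      forall (s : seq G) (c : G -> F), uniq s -> (forall x, x \in s -> E (c x)) ->
        (forall x y, x \in s -> y \in s -> x != y -> ~ E (chi (x - y))) ->
        \sum_(x <- s) c x * chi x = 0 -> forall x, x \in s -> c x = 0].
Proof.
(* One square root of -1 is enough, the other being its opposite. *)
have [si Hsi] : exists si : seq F, forall z, z ^+ 2 = -1 -> field_gen si z.
  have [[z z2]|nz] := pselect (exists z : F, z ^+ 2 = -1); last first.
    by exists [::] => z z2; case: nz; exists z.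
  exists [:: z] => w w2; have zg : field_gen [:: z] z by apply: field_gen_mem; rewrite inE.
  have : (w - z) * (w + z) == 0 by rewrite -subr_sqr w2 z2 subrr.
  rewrite mulf_eq0 subr_eq0 addr_eq0 => /orP[/eqP -> //|/eqP ->].
  have [E1 EB _ _] := field_gen_subfield [:: z].
  by rewrite -sub0r; apply: (EB) => //; rewrite -(subrr 1); apply: (EB).
pose s := s0 ++ si ++ map chi hs.
have hsE h : h \in hs -> field_gen s (chi h).
  by move=> hh; apply: field_gen_mem; rewrite !mem_cat map_f ?orbT.
(* The bound concerns the field before the roots of unity are adjoined; the norm carries it over to
   the larger field [E]. *)
have [B HB] := prime_root_bound F0 chiD chi_neq0 chi_inj hs_tors hsE HB0.
have [zs [zs1 zs2]] := roots_of_unity_seq F B.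
have [nu [d nm]] := norm_map_roots s zs2.
pose s' := s ++ zs; pose E := field_gen s'.
have EE' y : field_gen s y -> E y.
  by apply: field_gen_sub => x xs; rewrite mem_cat xs.
have Esub : subfield E := field_gen_subfield s'.
have [E1 EB EM EV] := Esub.
exists E; split => //.
- by move=> y ys; apply: field_gen_mem; rewrite !mem_cat ys.
- by apply: (preim_fin_gen F0 chiD chi_neq0 chi_inj hs_tors) => h hh; exact: (EE' _ (hsE h hh)).
move=> sG c usG cE sdiff sum0 x xs.
have [K [iota KP]] := subfield_typeP Esub.
have /choice[c' c'E] : forall y, exists a, y \in sG -> c y = iota a.
  move=> y; have [ys|nys] := boolP (y \in sG); last by exists 0.
  by have [a ->] := (KP _).1 (cE y ys); exists a.
rewrite c'E //; have -> : c' x = 0; last by rewrite rmorph0.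
apply: (character_independent (iota := iota) (chi := chi) F0 chiD chi_neq0) xs => //.
- move=> y; have [n n0 yn] := hs_tors y.
  have /KP[a ya] : E (chi (y *+ n)).
    by apply: (character_span chiD chi_neq0 Esub) yn => h hh; exact: (EE' _ (hsE h hh)).
  by exists n, a; rewrite -(characterMn chiD chi_neq0).
- move=> p a y pp ay.
  have Ea : E (iota a) by apply/KP; exists a.
  have a0 : iota a != 0.
    apply/eqP => a0; move/eqP: ay; rewrite a0 mul0r expr0n.
    by rewrite gtn_eqF ?prime_gt0 // eq_sym oner_eq0.
  apply/KP; suff h : E (iota a * chi y).
    by rewrite -(mulKf a0 (chi y)); apply: (EM) => //; apply: (EV).
  (* Roots of order at most B were adjoined; for larger p the norm argument applies. *)
  have [pB|Bp] := leqP p B.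
    by apply: field_gen_mem; rewrite mem_cat (zs1 _ p) ?orbT.
  exact: (norm_map_prime_root nm (field_gen_subfield s) Esub EE' hsE HB pp Ea ay Bp).
- move=> z /Hsi zsi; apply/KP; apply: (EE'); apply: field_gen_sub zsi => y ys.
  by rewrite !mem_cat ys orbT.
- by move=> y w ys ws yw [a ya]; apply: (sdiff y w ys ws yw); apply/KP; exists a.
by rewrite -[RHS]sum0; apply: eq_big_seq => y ys; rewrite -c'E.
Qed.
End GoodSubfield.

(** * Abelian groups of finite rank *)

Section AbelianGroup.
Variable G : zmodType.
Implicit Types (s : seq G) (H : set G).

Lemma span_consP g s x : Defs.span (g :: s) x <->
  exists z h, Defs.span s h /\ x = g *~ z + h.
Proof.
split=> [[z ->]|[z [_ [[w ->] ->]]]].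
  rewrite big_ord_recl /=; exists (z ord0), (\sum_(i < size s) s`_i *~ z (lift ord0 i)).
  by split=> //; exists (fun i => z (lift ord0 i)).
exists (fun i => if unlift ord0 i is Some j then w j else z).
rewrite big_ord_recl /= unlift_none; congr (_ + _).
by apply: eq_bigr => i _; rewrite liftK.
Qed.

Lemma span_nilP (x : G) : Defs.span [::] x <-> x = 0.
Proof.
split=> [[z ->]|->]; first by rewrite big_ord0.
by case: (span_subgroup (Nil G)).
Qed.

Definition independent s := forall z : 'I_(size s) -> int,
  \sum_(i < size s) s`_i *~ z i = 0 -> forall i, z i = 0.

Lemma independent_cons g s : independent s ->
  (forall n, (0 < n)%N -> ~ Defs.span s (g *+ n)) -> independent (g :: s).
Proof.
move=> ind ng z; rewrite big_ord_recl /= => z0.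
have z00 : z ord0 = 0.
  apply: contrapT => /eqP znz; apply: (ng `|z ord0|%N); first by rewrite absz_gt0.
  have h : Defs.span s (g *~ z ord0).
    exists (fun i => - z (lift ord0 i)).
    move/eqP: z0; rewrite addr_eq0 => /eqP ->; rewrite -sumrN.
    by apply: eq_bigr => i _; rewrite mulrNz.
  by rewrite pmulrn abszEsg mulrC mulrzA; exact: subgroupMz (span_subgroup s) h.
move: z0; rewrite z00 mulr0z add0r => /ind zs i.
by case: (unliftP ord0 i) => [j ->|->].
Qed.

(** Writing s through t and t through s gives integer matrices whose product is the identity, by
    independence of s. *)
Lemma independent_span_leq s t : independent s ->
  (Defs.span s `<=` Defs.span t)%classic -> (Defs.span t `<=` Defs.span s)%classic ->
  (size s <= size t)%N.
Proof.
move=> ind st ts.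
have /choice[A AE] : forall i : 'I_(size s), exists z : 'I_(size t) -> int,
    s`_i = \sum_(j < size t) t`_j *~ z j.
  by move=> i; apply/st/span_mem/mem_nth.
have /choice[B BE] : forall j : 'I_(size t), exists z : 'I_(size s) -> int,
    t`_j = \sum_(i < size s) s`_i *~ z i.
  by move=> i; apply/ts/span_mem/mem_nth.
pose MA : 'M[int]_(size s, size t) := \matrix_(i, j) A i j.
pose MB : 'M[int]_(size t, size s) := \matrix_(i, j) B i j.
apply: (@mulmx1_min _ _ _ MA MB); apply/matrixP => i k.
have E : \sum_(k < size s) s`_k *~ ((MA *m MB) i k - (i == k)%:Z) = 0.
  under eq_bigr do rewrite mulrzBr; rewrite sumrB.
  have -> : \sum_(l < size s) s`_l *~ (i == l)%:Z = s`_i.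
    rewrite (bigD1 i) //= eqxx mulr1z big1 ?addr0 // => l /negPf li.
    by rewrite eq_sym li mulr0z.
  apply/eqP; rewrite subr_eq0; apply/eqP; rewrite [RHS]AE.
  transitivity (\sum_(l < size s) \sum_(j < size t) s`_l *~ (A i j * B j l)).
    apply: eq_bigr => l _; rewrite mxE -mulrz_sumr; congr (_ *~ _).
    by apply: eq_bigr => j _; rewrite !mxE.
  rewrite exchange_big; apply: eq_bigr => j _; rewrite BE mulrz_suml.
  by apply: eq_bigr => l _; rewrite mulrC mulrzA.
have /eqP := ind _ E k; rewrite subr_eq0 => /eqP ->; rewrite mxE.
by case: (i == k).
Qed.

(** If no finite list works, independent lists can be prolonged forever; one of length r + 1
    contradicts rank at most r. *)
Lemma finite_rank_tors : finite_rank G ->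
  exists hs, forall g : G, exists2 n, (0 < n)%N & Defs.span hs (g *+ n).
Proof.
move=> [r Hr]; apply: contrapT => nhs.
have /choice[ext extP] : forall hs : seq G, exists g,
    forall n, (0 < n)%N -> ~ Defs.span hs (g *+ n).
  move=> hs; apply: contrapT => ng; apply: nhs; exists hs => g.
  apply: contrapT => gn; apply: ng; exists g => n n0 h; apply: gn; by exists n.
pose fix s n := if n is m.+1 then ext (s m) :: s m else [::] : seq G.
have szs n : size (s n) = n by elim: n => //= n ->.
have inds n : independent (s n).
  elim: n => [|n IH]; first by move=> z _ [].
  exact: independent_cons IH (extP _).
have [t [tr tE]] := Hr (s r.+1).
have := independent_span_leq (inds r.+1) (t := t); rewrite tE szs => h.
have := h (fun _ => id) (fun _ => id).
by move=> /leq_trans/(_ tr); rewrite ltnn.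
Qed.

Lemma coprime_annihilator m n (x : G) : coprime m n -> x *+ m = 0 -> x *+ n = 0 -> x = 0.
Proof.
move=> cop xm xn; have [n0|n0] := posnP n.
  by move: cop; rewrite n0 /coprime gcdn0 => /eqP m1; rewrite -xm m1 mulr1n.
have [a b ab _] := egcdnP m n0.
have : x *+ (a * n) = x *+ (b * m + 1).
  by rewrite ab; move: cop; rewrite coprime_sym => /eqP ->.
have -> : x *+ (a * n) = 0 by rewrite mulnC mulrnA xn mul0rn.
have bm : x *+ (b * m) = 0 by rewrite mulnC mulrnA xm mul0rn.
by rewrite mulrnDr mulr1n bm add0r => <-.
Qed.

Lemma quasicyclic_annihilator (Q : set G) : quasicyclic Q ->
  exists p, prime p /\ forall g : G, Q g -> exists a, g *+ (p ^ a) = 0.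
Proof.
move=> [p [x [pp _ x0 xS ->]]]; exists p; split=> // _ [n [m ->]].
exists n.+1; rewrite -mulrnA mulnC mulrnA.
suff -> : x n *+ (p ^ n.+1) = 0 by rewrite mul0rn.
elim: n => [|n IH]; first by rewrite expn1.
by rewrite expnS mulrnA xS.
Qed.

(** A torsion element is d + c_j, with d annihilated by a product of powers of the primes of the
    quasicyclic factors, and c_j by some w_j from a finite list. A prime p above all those primes
    and all the w_j is coprime to this common annihilator, so no nonzero element is killed by p. *)
Lemma chernikov_prime_bound : chernikov (torsion G) ->
  exists B, forall p (x : G), prime p -> x *+ p = 0 -> x != 0 -> (p <= B)%N.
Proof.
move=> [m [Q [c /= [hQ _ _ hT]]]].
have /choice[pr prP] : forall i, exists p, prime p /\
    forall g : G, Q i g -> exists a, g *+ (p ^ a) = 0.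
  by move=> i; exact: quasicyclic_annihilator.
(* Members of [c] need not be torsion; the value 1 is a placeholder for those that are not. *)
have /choice[w wP] : forall j, exists w, (0 < w)%N /\ (torsion G c`_j -> c`_j *+ w = 0).
  move=> j; have [[n [n0 cn]]|nt] := pselect (torsion G c`_j); first by exists n.
  by exists 1%N; split=> // /nt.
exists (\max_(i < m) pr i + \max_(j < (size c).+1) w j)%N => p x pp xp.
apply: contraNT; rewrite -ltnNge => Bp.
have xt : torsion G x by exists p; rewrite prime_gt0.
have [_ [j [[q [qQ ->]] xE]]] := hT x xt.
(* An index past the end of [c] yields the default 0; the extra index [size c] stands for all of
   these. *)
have {}xE : exists j' : 'I_(size c).+1, x = \sum_(i < m) q i + c`_j'.
  have [jc|jc] := ltnP j (size c); first by exists (Ordinal (leqW jc : (j < (size c).+1)%N)).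
  by exists ord_max; rewrite xE !nth_default.
move: xE => {j} [j xE].
have /choice[a aP] : forall i, exists a, q i *+ (pr i ^ a) = 0.
  by move=> i; exact: (prP i).2 _ (qQ i).
pose M := (\prod_(i < m) pr i ^ a i)%N.
have dM : (\sum_(i < m) q i) *+ M = 0.
  rewrite -sumrMnl big1 // => i _; rewrite /M (bigD1 i) //= mulrnA aP mul0rn //.
have wc : c`_j *+ w j = 0.
  apply: (wP j).2; exists (p * M)%N; split.
    rewrite muln_gt0 prime_gt0 //= prodn_gt0 // => i.
    by rewrite expn_gt0 prime_gt0 //; case: (prP i).
  have -> : c`_j = x - \sum_(i < m) q i by rewrite xE addrC addKr.
  by rewrite mulrnBl mulrnA xp mul0rn mulnC mulrnA dM mul0rn subrr.
apply/eqP; apply: (@coprime_annihilator p (M * w j)%N) => //.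
  rewrite coprimeMr; apply/andP; split.
    rewrite /M; elim/big_ind: _ => [|u v cu cv|i _]; first exact: coprimen1.
      by rewrite coprimeMr cu.
    rewrite coprimeXr // prime_coprime // dvdn_prime2 //; last by case: (prP i).
    apply: contraTneq Bp => ->; rewrite -leqNgt.
    by apply: leq_trans (leq_addr _ _); exact: (leq_bigmax (F := pr) i).
  rewrite prime_coprime //; apply/negP => /(dvdn_leq (wP j).1) pw; move: Bp.
  rewrite ltnNge (leq_trans pw) //; apply: leq_trans (leq_addl _ _).
  exact: (leq_bigmax (F := fun j : 'I_(size c).+1 => w j) j).
by rewrite xE mulrnDl mulrnA dM mul0rn add0r mulnC mulrnA wc mul0rn.
Qed.

(** Let d be the least positive coefficient of g among elements of H. Euclidean division by d
    reduces every element of H to H meet span s, which is handled by induction. *)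
Lemma fin_gen_sub s H : subgroup H -> (H `<=` Defs.span s)%classic -> fin_gen_subgroup H.
Proof.
elim: s H => [|g s IH] H HH Hs.
  exists [::]; apply/seteqP; split=> // x /span_nilP ->; by case: HH.
have [t tE] : fin_gen_subgroup (H `&` Defs.span s)%classic.
  apply: IH; last by move=> x [].
  have [S0 SB] := span_subgroup s; have [H0 HB] := HH.
  by split=> [//|x y [Hx Sx] [Hy Sy]]; split; [exact: HB | exact: SB].
have tH x : Defs.span t x -> H x by rewrite -tE => -[].
pose coef (d : nat) := exists2 h, Defs.span s h & H (g *+ d + h).
have [nz|nz] := pselect (exists d, (0 < d)%N /\ coef d); last first.
  exists t; apply/seteqP; split=> [x Hx|x /tH //].
  have /span_consP[z [h [sh xE]]] := Hs x Hx.
  rewrite -tE; split=> //; have [z0|z0] := eqVneq z 0.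
    by rewrite xE z0 mulr0z add0r.
  case: nz; exists `|z|%N; rewrite absz_gt0 z0; split=> //.
  exists (h *~ sgz z); first exact: subgroupMz (span_subgroup s) sh.
  by rewrite pmulrn abszEsg mulrC mulrzA -mulrzDl -xE; exact: subgroupMz.
have ex : exists d, (0 < d)%N && `[< coef d >].
  by have [d [d0 dc]] := nz; exists d; rewrite d0; apply/asboolP.
have [d /andP[d0 /asboolP[h0 sh0 Hx0]] dmin] := ex_minnP ex.
pose x0 := g *+ d + h0.
exists (x0 :: t); apply/seteqP; split; last first.
  apply: span_sub => // x; rewrite inE => /orP[/eqP -> //|xt].
  by apply/tH/span_mem.
move=> y Hy; apply/span_consP.
have /span_consP[z [h [sh yE]]] := Hs y Hy.
exists (z %/ d)%Z, (y - x0 *~ (z %/ d)%Z); split; last by rewrite addrC subrK.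
have Hr : H (y - x0 *~ (z %/ d)%Z).
  by apply: (HH.2) => //; exact: subgroupMz.
have dz : d%:Z != 0 by rewrite eqz_nat -lt0n.
have rE : y - x0 *~ (z %/ d)%Z = g *+ `|(z %% d)%Z|%N + (h - h0 *~ (z %/ d)%Z).
  rewrite yE /x0 !pmulrn gez0_abs ?modz_ge0 // mulrzDl {1}(divz_eq z d) mulrzDr.
  rewrite [(_ * _)%R]mulrC mulrzA opprD.
  by rewrite addrACA; congr (_ + _); rewrite addrAC subrr add0r.
have sh' : Defs.span s (h - h0 *~ (z %/ d)%Z).
  by apply: (span_subgroup s).2 => //; exact: subgroupMz (span_subgroup s) sh0.
rewrite -tE; split=> //; rewrite rE.
suff -> : `|(z %% d)%Z|%N = 0%N by rewrite mulr0n add0r.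
apply/eqP; rewrite -leqn0 leqNgt; apply/negP => r0.
have : (d <= `|(z %% d)%Z|)%N.
  by apply: dmin; rewrite r0; apply/asboolP; exists (h - h0 *~ (z %/ d)%Z) => //; rewrite -rE.
by rewrite leqNgt -ltz_nat gez0_abs ?modz_ge0 // ltz_pmod.
Qed.
End AbelianGroup.

(** * The prime quotient of the group algebra *)

Section FormalSums.
Variables (k : fieldType) (G : zmodType).
Implicit Types (l : seq (k * G)) (f g : G -> k).

(** Lists of terms, possibly with repetitions, present the elements of kG: sums become
    concatenations and convolution a finite sum over pairs. *)
Definition of_list l : G -> k := fun x => \sum_(u <- l) u.1 *+ (u.2 == x).

Definition opp_list l : seq (k * G) := [seq (- u.1, u.2) | u <- l].

Definition mul_list l l' : seq (k * G) :=
  [seq (u.1 * v.1, u.2 + v.2) | u <- l, v <- l'].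

Lemma of_list_cat l l' x : of_list (l ++ l') x = of_list l x + of_list l' x.
Proof. by rewrite /of_list big_cat. Qed.

Lemma of_list_opp l x : of_list (opp_list l) x = - of_list l x.
Proof.
by rewrite /of_list big_map -sumrN; apply: eq_bigr => u _; rewrite mulNrn.
Qed.

Lemma of_list_mulE l l' x :
  of_list (mul_list l l') x = \sum_(u <- l) u.1 * of_list l' (x - u.2).
Proof.
rewrite /of_list big_allpairs_dep; apply: eq_bigr => u _.
rewrite mulr_sumr; apply: eq_bigr => v _ /=.
have -> : (v.2 == x - u.2) = (u.2 + v.2 == x) by rewrite eq_sym subr_eq eq_sym addrC.
by rewrite mulrnAr.
Qed.

Lemma of_list_notin l x : x \notin map snd l -> of_list l x = 0.
Proof.
move=> xl; rewrite /of_list big_seq big1 // => u ul.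
by case: eqP => // ux; rewrite -ux map_f in xl.
Qed.

Lemma of_list_kG l : kG k G (of_list l).
Proof.
apply: (@sub_finite_set _ _ [set` map snd l]); last exact: finite_seq.
move=> x /= fx; apply: contraNT fx => xl; rewrite of_list_notin //.
Qed.

Lemma kG_mul_of_list l g x :
  kG_mul (of_list l) g x = \sum_(u <- l) u.1 * g (x - u.2).
Proof.
rewrite /kG_mul (fsbigE (undup (map snd l))) ?undup_uniq //; last first.
  by move=> h _; rewrite mem_undup => hl; rewrite of_list_notin // mul0r.
transitivity (\sum_(h <- undup (map snd l)) \sum_(u <- l) (u.1 *+ (u.2 == h)) * g (x - h)).
  by rewrite big_mkcond; apply: eq_bigr => h _; rewrite in_setT /of_list mulr_suml.
rewrite exchange_big /=; apply: eq_big_seq => u ul.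
rewrite (bigD1_seq u.2) ?undup_uniq ?mem_undup ?map_f //= eqxx mulr1n big1 ?addr0 //.
by move=> h /negPf hu; rewrite eq_sym hu mulr0n mul0r.
Qed.

Lemma kG_mul_lists l l' : kG_mul (of_list l) (of_list l') = of_list (mul_list l l').
Proof. by apply/funext => x; rewrite kG_mul_of_list of_list_mulE. Qed.

Lemma kG_listP f : kG k G f -> exists l, f = of_list l.
Proof.
move=> /finite_seqP[s sE].
have sP x : (x \in s) = (f x != 0).
  have /= h : [set g | f g != 0]%classic x = [set` s]%classic x by rewrite sE.
  by apply/idP/idP => fx; [rewrite h | rewrite -h].
exists [seq (f x, x) | x <- undup s]; apply/funext => x.
rewrite /of_list big_map /=; have [xs|xs] := boolP (x \in s).
  rewrite (bigD1_seq x) ?undup_uniq ?mem_undup //= eqxx mulr1n big1 ?addr0 //.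
  by move=> y /negPf ->; rewrite mulr0n.
rewrite big_seq big1 => [|y]; first by apply/eqP; move: xs; rewrite sP negbK.
by rewrite mem_undup => ys; case: eqP => // yx; rewrite -yx ys in xs.
Qed.

Lemma kG_elt_list (g : G) : kG_elt k g = of_list [:: (1, g)].
Proof.
by apply/funext => x; rewrite /of_list /kG_elt big_seq1 /= eq_sym; case: eqP.
Qed.

Lemma mul_listC l l' : of_list (mul_list l l') = of_list (mul_list l' l).
Proof.
apply/funext => x; rewrite /of_list !big_allpairs_dep exchange_big /=.
by apply: eq_bigr => v _; apply: eq_bigr => u _; rewrite mulrC addrC.
Qed.

Lemma mul_listA l1 l2 l3 :
  of_list (mul_list l1 (mul_list l2 l3)) = of_list (mul_list (mul_list l1 l2) l3).
Proof.
apply/funext => x; rewrite /of_list !big_allpairs_dep /=; apply: eq_bigr => u _.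
rewrite big_allpairs_dep; apply: eq_bigr => v _; apply: eq_bigr => w _ /=.
by rewrite mulrA addrA.
Qed.

Lemma mul_list1 l : of_list (mul_list [:: (1, 0)] l) = of_list l.
Proof. by apply/funext => x; rewrite of_list_mulE big_seq1 mul1r subr0. Qed.

Lemma mul_listDl l1 l2 l3 :
  of_list (mul_list (l1 ++ l2) l3) = of_list (mul_list l1 l3 ++ mul_list l2 l3).
Proof. by apply/funext => x; rewrite of_list_cat !of_list_mulE big_cat. Qed.
End FormalSums.

Lemma ideal_add (k : fieldType) (G : zmodType) (I : set (G -> k)) a b :
  Defs.ideal I -> I a -> I b -> I (fun x => a x + b x).
Proof.
move=> [_ I0 IB _] Ia Ib; have := IB _ _ Ia (IB _ _ I0 Ib).
by congr I; apply/funext => x; rewrite /kG_add sub0r opprK.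
Qed.

Section PrimeQuotient.
Variables (k : fieldType) (G : zmodType) (P : set (G -> k)).
Hypothesis primeP : prime_ideal P.
Implicit Types (l : seq (k * G)).

Let P0 : P (fun _ => 0). Proof. by case: primeP => -[_ I0 _ _] _ _. Qed.
Let PD a b : P a -> P b -> P (fun x => a x + b x).
Proof. by apply: ideal_add; case: primeP. Qed.
Let PN a : P a -> P (fun x => - a x).
Proof.
case: primeP => -[_ _ PB _] _ _ Pa; have := PB _ _ P0 Pa.
by congr P; apply/funext => x; rewrite /kG_add sub0r.
Qed.
Let PM a b : P a -> kG k G b -> P (kG_mul a b).
Proof. by case: primeP => -[_ _ _ IM] _ _; exact: IM. Qed.

(** kG/P is built as a quotient of the type of lists, each of which denotes an element of kG, so no
    subtype of functions is involved. *)
Definition ideal_rel l l' : bool := `[< P (fun x => of_list l x - of_list l' x) >].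

Lemma ideal_rel_equiv : equiv_class_of ideal_rel.
Proof.
split=> [l|l l'|l2 l1 l3].
- by apply/asboolP; move: P0; congr P; apply/funext => x; rewrite subrr.
- by apply/asboolP/asboolP => /PN; congr P; apply/funext => x; rewrite opprB.
- move=> /asboolP h1 /asboolP h2; apply/asboolP; move: (PD h1 h2).
  by congr P; apply/funext => x; rewrite addrA subrK.
Qed.
Canonical ideal_equiv := EquivRelPack ideal_rel_equiv.

Definition kG_quot := {eq_quot ideal_rel}.
HB.instance Definition _ := Choice.on kG_quot.

Definition cls l : kG_quot := \pi_kG_quot l.

Lemma cls_eqP l l' : cls l = cls l' <-> P (fun x => of_list l x - of_list l' x).
Proof.
split=> [/eqmodP/asboolP //|h]; apply/eqmodP; exact/asboolP.
Qed.

Lemma cls_eq l l' : of_list l = of_list l' -> cls l = cls l'.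
Proof.
by move=> ll; apply/cls_eqP; rewrite ll; move: P0; congr P; apply/funext => x; rewrite subrr.
Qed.

Definition rep (x : kG_quot) : seq (k * G) := repr x.
Lemma cls_rep x : cls (rep x) = x. Proof. exact: reprK. Qed.

Definition qadd (x y : kG_quot) := cls (rep x ++ rep y).
Definition qopp (x : kG_quot) := cls (opp_list (rep x)).
Definition qmul (x y : kG_quot) := cls (mul_list (rep x) (rep y)).

Lemma qaddE l l' : qadd (cls l) (cls l') = cls (l ++ l').
Proof.
have /cls_eqP h := cls_rep (cls l); have /cls_eqP h' := cls_rep (cls l').
apply/cls_eqP; move: (PD h h'); congr P; apply/funext => x.
by rewrite !of_list_cat opprD addrACA.
Qed.

Lemma qoppE l : qopp (cls l) = cls (opp_list l).
Proof.
have /cls_eqP/PN h := cls_rep (cls l); apply/cls_eqP; move: h; congr P; apply/funext => x.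
by rewrite !of_list_opp opprD.
Qed.

Lemma cls_mull l1 l2 l : cls l1 = cls l2 -> cls (mul_list l1 l) = cls (mul_list l2 l).
Proof.
move=> /cls_eqP h; apply/cls_eqP; have := PM h (of_list_kG l).
have -> : (fun x => of_list l1 x - of_list l2 x) = of_list (l1 ++ opp_list l2).
  by apply/funext => x; rewrite of_list_cat of_list_opp.
rewrite kG_mul_lists; congr P; apply/funext => x.
rewrite mul_listDl of_list_cat; congr (_ + _).
by rewrite !of_list_mulE big_map -sumrN; apply: eq_bigr => u _; rewrite mulNr.
Qed.

Lemma qmulE l l' : qmul (cls l) (cls l') = cls (mul_list l l').
Proof.
rewrite /qmul (cls_mull _ (cls_rep (cls l))) (cls_eq (mul_listC _ _)).
by rewrite (cls_mull _ (cls_rep (cls l'))); apply: cls_eq; exact: mul_listC.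
Qed.

Lemma clsW (Q : kG_quot -> Prop) : (forall l, Q (cls l)) -> forall x, Q x.
Proof. by move=> h x; rewrite -(cls_rep x). Qed.

Lemma qaddA : associative qadd.
Proof.
elim/clsW=> a; elim/clsW=> b; elim/clsW=> c.
by rewrite !qaddE catA.
Qed.

Lemma qaddC : commutative qadd.
Proof.
elim/clsW=> a; elim/clsW=> b; rewrite !qaddE; apply: cls_eq; apply/funext => x.
by rewrite !of_list_cat addrC.
Qed.

Lemma qadd0 : left_id (cls [::]) qadd.
Proof. by elim/clsW=> a; rewrite qaddE. Qed.

Lemma qaddN : left_inverse (cls [::]) qopp qadd.
Proof.
elim/clsW=> a; rewrite qoppE qaddE; apply: cls_eq; apply/funext => x.
by rewrite of_list_cat of_list_opp addNr /of_list big_nil.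
Qed.

HB.instance Definition _ := GRing.isZmodule.Build kG_quot qaddA qaddC qadd0 qaddN.

Lemma qmulA : associative qmul.
Proof.
elim/clsW=> a; elim/clsW=> b; elim/clsW=> c; rewrite !qmulE.
exact/cls_eq/mul_listA.
Qed.

Lemma qmulC : commutative qmul.
Proof.
by elim/clsW=> a; elim/clsW=> b; rewrite !qmulE; apply: cls_eq; exact: mul_listC.
Qed.

Lemma qmul1 : left_id (cls [:: (1, 0)]) qmul.
Proof. by elim/clsW=> a; rewrite qmulE; apply: cls_eq; exact: mul_list1. Qed.

Lemma qmulDl : left_distributive qmul qadd.
Proof.
elim/clsW=> a; elim/clsW=> b; elim/clsW=> c; rewrite !(qaddE, qmulE).
exact/cls_eq/mul_listDl.
Qed.

Lemma cls_eq0 l : cls l = cls [::] <-> P (of_list l).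
Proof.
rewrite cls_eqP; suff -> : (fun x => of_list l x - of_list [::] x) = of_list l by [].
by apply/funext => x; rewrite /of_list big_nil subr0.
Qed.

Lemma qone_neq0 : cls [:: (1, 0)] != cls [::].
Proof. by apply/eqP => /cls_eq0; rewrite -kG_elt_list; case: primeP. Qed.

HB.instance Definition _ := GRing.Zmodule_isComNzRing.Build kG_quot
  qmulA qmulC qmul1 qmulDl qone_neq0.

(** Invertibility is decided classically to provide the inverse map that the structure of integral
    domain carries, as [fraction] requires. *)
Definition qunit (x : kG_quot) : bool := `[< exists y, y * x = 1 >].
Definition qinv (x : kG_quot) : kG_quot :=
  if pselect (exists y, y * x = 1) is left h then projT1 (cid h) else x.

Lemma qmulV : {in qunit, left_inverse 1 qinv *%R}.
Proof.
move=> x /asboolP xu; rewrite /qinv; case: pselect => // h.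
by case: (cid h).
Qed.
Lemma qunitP (x y : kG_quot) : y * x = 1 -> qunit x.
Proof. by move=> h; apply/asboolP; exists y. Qed.
Lemma qinv_out : {in [predC qunit], qinv =1 id}.
Proof. by move=> x /asboolP xu; rewrite /qinv; case: pselect. Qed.

HB.instance Definition _ := GRing.ComNzRing_hasMulInverse.Build kG_quot
  qmulV qunitP qinv_out.

Lemma qintegral : GRing.integral_domain_axiom kG_quot.
Proof.
elim/clsW=> a; elim/clsW=> b; rewrite /GRing.mul /= qmulE => /cls_eq0.
case: primeP => _ _ Pprime; rewrite -kG_mul_lists => /Pprime[||/cls_eq0 ->|/cls_eq0 ->].
- exact: of_list_kG.
- exact: of_list_kG.
- by rewrite eqxx.
- by rewrite eqxx orbT.
Qed.

HB.instance Definition _ := GRing.ComUnitRing_isIntegral.Build kG_quot qintegral.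

(** Presents P as the kernel of an evaluation of formal sums, with values in the fraction field of
    kG/P. *)
Lemma prime_quotient_field : exists (F : fieldType) (kappa : {rmorphism k -> F}) (chi : G -> F),
  [/\ forall x y, chi (x + y) = chi x * chi y, forall x, chi x != 0 &
      forall l, P (of_list l) <-> \sum_(u <- l) kappa u.1 * chi u.2 = 0].
Proof.
pose F : fieldType := {fraction kG_quot}.
pose del (c : k) (g : G) : kG_quot := cls [:: (c, g)].
have delM c g c' g' : del c g * del c' g' = del (c * c') (g + g').
  by rewrite /del [LHS]qmulE.
have delB : zmod_morphism (fun c => tofrac (del c 0) : F).
  move=> c c'; rewrite -rmorphB; congr (tofrac _).
  rewrite -[RHS]/(qadd (cls _) (qopp (cls _))) qoppE qaddE; apply: cls_eq.
  by apply/funext => x; rewrite /of_list /= !big_cons !big_nil !addr0 /= mulrnBl mulNrn.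
have delMM : monoid_morphism (fun c => tofrac (del c 0) : F).
  by split=> [|c c']; [exact: rmorph1 | rewrite -rmorphM delM addr0].
pose kz := GRing.isZmodMorphism.Build k F _ delB.
pose km := GRing.isMonoidMorphism.Build k F _ delMM.
pose kappa : {rmorphism k -> F} := HB.pack (fun c => tofrac (del c 0) : F) kz km.
exists F, kappa, (fun g => tofrac (del 1 g)); split.
- by move=> x y; rewrite -rmorphM delM mulr1.
- move=> x; rewrite tofrac_eq0; apply/eqP => x0.
  have : del 1 x * del 1 (- x) = 1 by rewrite delM mulr1 subrr.
  by rewrite x0 mul0r => /eqP; rewrite eq_sym oner_eq0.
move=> l; rewrite -cls_eq0.
have -> : \sum_(u <- l) kappa u.1 * tofrac (del 1 u.2) = tofrac (cls l).
  elim: l => [|u l IH]; first by rewrite big_nil [cls _]/(0 : kG_quot) rmorph0.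
  rewrite big_cons IH /= -rmorphM delM mulr1 add0r -rmorphD; congr (tofrac _).
  by rewrite -[LHS]/(qadd _ _) qaddE; case: (u).
split=> [->|/eqP]; first by rewrite [cls _]/(0 : kG_quot) rmorph0.
by rewrite tofrac_eq0 => /eqP.
Qed.
End PrimeQuotient.

(** * Control of P and conclusion *)

Lemma coset_rep (G : zmodType) (H : set G) : subgroup H ->
  exists rep : G -> G, (forall x, H (rep x - x)) /\
    (forall x y, H (x - y) -> rep x = rep y).
Proof.
move=> HH; have ex x : exists y, `[< H (y - x) >].
  by exists x; apply/asboolP; rewrite subrr; case: HH.
exists (fun x => xchoose (ex x)); split=> [x|x y xy].
  by have /asboolP := xchooseP (ex x).
(* Congruent elements define equivalent predicates, and [xchoose] depends on the predicate only up
   to equivalence. *)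
apply: eq_xchoose => z; apply/asboolP/asboolP => h.
  by rewrite -(subrK x z) -addrA; exact: subgroupD.
rewrite -(subrK y z) -addrA; apply: subgroupD => //.
by rewrite -opprB; exact: subgroupN.
Qed.

Lemma ideal_gen_sub (k : fieldType) (G : zmodType) (I J : set (G -> k)) :
  Defs.ideal I -> (J `<=` I)%classic -> (ideal_gen J `<=` I)%classic.
Proof.
move=> II JI _ [n [a [b [Ja kb ->]]]].
have [_ I0 _ IM] := II.
elim: n a b Ja kb => [|n IH] a b Ja kb.
  by move: I0; congr I; apply/funext => x; rewrite big_ord0.
have h1 : I (fun x => \sum_(i < n) kG_mul (a (lift ord0 i)) (b (lift ord0 i)) x).
  by apply: (IH (fun i => a (lift ord0 i)) (fun i => b (lift ord0 i))).
have h0 : I (kG_mul (a ord0) (b ord0)) by apply: IM => //; apply: JI.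
move: (ideal_add II h0 h1); congr I; apply/funext => x.
by rewrite big_ord_recl.
Qed.

Section Controls.
Variables (k : fieldType) (G : zmodType) (P : set (G -> k)).
Variables (F : fieldType) (kappa : {rmorphism k -> F}) (chi : G -> F).
Hypothesis chiD : forall x y, chi (x + y) = chi x * chi y.
Hypothesis evP : forall l, P (of_list l) <-> \sum_(u <- l) kappa u.1 * chi u.2 = 0.
Hypothesis idealP : Defs.ideal P.

(** Split f in P along the cosets of H as a sum of f_r r with f_r in kH. Evaluation yields a
    relation between the chi(r) with coefficients in E. These coefficients vanish by independence,
    which says that each f_r lies in P. *)
Lemma controls_independent (E : set F) : subfield E -> (forall c, E (kappa c)) ->
  subgroup [set g | E (chi g)] ->
  (forall (s : seq G) (c : G -> F), uniq s -> (forall x, x \in s -> E (c x)) ->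
     (forall x y, x \in s -> y \in s -> x != y -> ~ E (chi (x - y))) ->
     \sum_(x <- s) c x * chi x = 0 -> forall x, x \in s -> c x = 0) ->
  controls [set g | E (chi g)] P.
Proof.
move=> Esub Ek HH ind; set H := [set g | E (chi g)]%classic in HH *.
have [PkG _ _ _] := idealP.
apply/seteqP; split; last by apply: ideal_gen_sub => // f [].
move=> f Pf; have [l fl] := kG_listP (PkG _ Pf).
have [rep [repH repE]] := coset_rep HH.
pose R := undup [seq rep u.2 | u <- l].
(* The terms of the coset of [r], translated into H. *)
pose part r := [seq (u.1, u.2 - r) | u <- l & rep u.2 == r].
have lsum (V : zmodType) (h : k * G -> V) :
    \sum_(u <- l) h u = \sum_(r <- R) \sum_(u <- part r) h (u.1, u.2 + r).
  transitivity (\sum_(r <- R) \sum_(u <- l | rep u.2 == r) h u).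
    rewrite (exchange_big_dep xpredT) //=; apply: eq_big_seq => u ul.
    rewrite -big_filter (_ : [seq r <- R | rep u.2 == r] = [:: rep u.2]) ?big_seq1 //.
    rewrite -(filter_pred1_uniq (s := R) (x := rep u.2)) ?undup_uniq //.
      by apply: eq_filter => r; rewrite /= eq_sym.
    by rewrite mem_undup map_f.
  apply: eq_bigr => r _; rewrite /part big_map big_filter; apply: eq_bigr => u _.
  by rewrite /= subrK; case: u.
have partH r u : u \in part r -> H u.2.
  move=> /mapP[v]; rewrite mem_filter => /andP[/eqP <- _] -> /=.
  by rewrite -opprB; apply: subgroupN.
pose c r := \sum_(u <- part r) kappa u.1 * chi u.2.
have c0 r : r \in R -> c r = 0.
  apply: ind => [|{}r rR|x y|].
  - exact: undup_uniq.
  - have [E1 EB EM EV] := Esub; rewrite /c.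
    have E0 : E 0 by rewrite -(subrr 1); exact: EB.
    elim: (part r) (partH r) => [|u l' IH] lH; first by rewrite big_nil.
    have ED a b : E a -> E b -> E (a + b).
      by move=> Ea Eb; rewrite -[b]opprK -[- b]sub0r; apply: (EB) => //; apply: (EB).
    rewrite big_cons; apply: ED; last by apply: IH => v vl; apply: lH; rewrite inE vl orbT.
    by apply: EM => //; apply: lH; rewrite mem_head.
  - rewrite !mem_undup => /mapP[u _ ->] /mapP[v _ ->] uv Euv; move/eqP: uv; apply.
    apply: repE; have := subgroupD HH (subgroupD HH (subgroupN HH (repH u.2)) Euv) (repH v.2).
    by rewrite opprB !addrA !subrK.
  - have /evP sum0 : P (of_list l) by rewrite -fl.
    rewrite -[RHS]sum0 (lsum F (fun u => kappa u.1 * chi u.2)).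
    apply: eq_bigr => r' _; rewrite /c mulr_suml; apply: eq_bigr => u _ /=.
    by rewrite chiD mulrA.
exists (size R), (fun i => of_list (part (nth 0 R i))),
  (fun i => of_list [:: (1, nth 0 R i)]); split=> [i|i|].
- have iR : nth 0 R i \in R by rewrite mem_nth.
  split; first by apply/evP; exact: c0.
  split; first exact: of_list_kG.
  move=> g; apply: contraNP => gH; apply/eqP; apply: of_list_notin.
  by apply/negP => /mapP[u /partH uH gu]; apply: gH; rewrite gu.
- exact: of_list_kG.
apply/funext => x; rewrite fl /of_list lsum (big_nth 0) big_mkord.
apply: eq_bigr => i _; rewrite kG_mul_of_list; apply: eq_bigr => u _.
rewrite /of_list big_seq1 /= [_ == x - _]eq_sym subr_eq eq_sym addrC.
by rewrite mulr_natr.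
Qed.
End Controls.

Unset Implicit Arguments.
Theorem theorem3p1 (k : fieldType) (G : zmodType) (P : set (G -> k)) :
  fin_gen_field k -> [pchar k] =i pred0 ->
  finite_rank G -> chernikov (torsion G) ->
  prime_ideal P -> faithful P ->
  fin_gen_subgroup (controller P).
Proof.
move=> [sk skP] k0 rkG cherG primeP faithP.
have [F [kappa [chi [chiD chi0 evP]]]] := prime_quotient_field primeP.
have F0 : [pchar F] =i pred0 by move=> p; rewrite (fmorph_pchar kappa) k0.
have chi_inj : injective chi.
  (* If chi(g) = chi(h), then (g - h) - 1 evaluates to zero, so it lies in P and faithfulness
     applies. *)
  move=> g h gh; apply/eqP; rewrite -subr_eq0; apply/eqP/faithP.
  have -> : kG_add (kG_elt k (g - h)) (fun x => - kG_elt k 0 x) =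
      of_list [:: (1, g - h); (-1, 0)].
    rewrite !kG_elt_list; apply/funext => x.
    by rewrite /kG_add /of_list !big_cons !big_nil !addr0 /= mulNrn.
  apply/evP; rewrite !big_cons big_nil addr0 /= rmorphN rmorph1 mulN1r mul1r.
  by rewrite (characterB chiD chi0) gh mulfV ?chi0 // (character0 chiD chi0) subrr.
have [hs hsP] := finite_rank_tors rkG.
have [B0 HB0] := chernikov_prime_bound cherG.
have [E [Esub Es Hfg ind]] :=
  exists_good_subfield F0 chiD chi0 chi_inj hsP HB0 (map kappa sk).
(* The preimage of E under [kappa] is a subfield containing the generators of k. *)
have Ek c : E (kappa c).
  have : [set c | E (kappa c)]%classic = setT.
    apply: skP => [|x xs]; last by apply: Es; apply: map_f.
    have [E1 EB EM EV] := Esub.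
    split=> [|x y Ex Ey|x y Ex Ey|x Ex] /=.
    - by rewrite rmorph1.
    - by rewrite rmorphB; exact: EB.
    - by rewrite rmorphM; exact: EM.
    - by rewrite fmorphV; exact: EV.
  by move=> /seteqP[_ /(_ c)]; exact.
have HH := preim_subgroup chiD chi0 Esub.
have ctrl : controls [set g | E (chi g)]%classic P.
  by apply: (controls_independent chiD evP) => //; case: primeP.
have [s sE] := Hfg.
(* The controller is contained in the finitely generated controlling subgroup chi^-1(E). *)
apply: (@fin_gen_sub _ s).
  split=> [H HH' _|x y Px Py H HH' cH]; first by case: HH'.
  by case: (HH') => _; apply; [exact: Px | exact: Py].
by move=> x /(_ _ HH ctrl); rewrite sE.
Qed.
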